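(* Let $\Gamma=(x_1,\dots,x_n)$ and $\Gamma'=(x'_1,\dots,x'_n)$ be ordered point clouds in the same metric space $(X,d)$, let $R=\max\{R_\Gamma,R_{\Gamma'}\}$, and let $d_\infty(\Gamma,\Gamma')=\max_{1\le i\le n}d(x_i,x'_i)$. Take homology with coefficients in a field and consider persistence modules indexed by $r>R$. Then for every $k$ and every $\mathcal F\in\{\ker,\operatorname{im},\operatorname{coker}\}$, $$d_B\bigl(\operatorname{Dgm}\mathcal F(H_k(\psi_\Gamma)),\operatorname{Dgm}\mathcal F(H_k(\psi_{\Gamma'}))\bigr)\le d_\infty(\Gamma,\Gamma').$$
   Context: $B(x,r)=\{y\in X\mid d(x,y)<r\}$ is the open ball. An ordered point cloud of length $n$ is a finite indexed family $\Gamma=(x_1,\dots,x_n)$ of (not necessarily distinct) points of $X$. Čech complex: $\check{\mathrm C}_r(\Gamma)$ is the simplicial complex whose simplices are the nonempty $\sigma\subset\{1,\dots,n\}$ with $\bigcap_{i\in\sigma}B(x_i,r)\neq\emptyset$. Its vertices are indices, so repeated points may give distinct vertices. Sample radius: $R_\Gamma=\inf\{r\ge 0\mid B(x_{i-1},r)\cap B(x_i,r)\neq\emptyset\text{ for all }2\le i\le n\}$. Elementary cubes in $\mathbb{R}^2$ are the products $I_1\times I_2$ with each $I_m$ either $[k,k]$ (also written $[k]$) or $[k,k+1]$, $k\in\mathbb{Z}$; the dimension is the number of factors of the form $[k,k+1]$. A cubical complex is a set of elementary cubes closed under faces (elementary cubes contained in a member). $C_k(K)$ is the vector space freely generated by the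 $k$-dimensional cubes of $K$, with boundary $\partial([i]\times[j])=0$, $\partial([i]\times[j,j+1])=[i]\times[j+1]-[i]\times[j]$, $\partial([i,i+1]\times[j])=[i+1]\times[j]-[i]\times[j]$, $\partial([i,i+1]\times[j,j+1])=[i+1]\times[j,j+1]-[i]\times[j,j+1]-[i,i+1]\times[j+1]+[i,i+1]\times[j]$. Distance complex: $\mathrm{DC}_r(\Gamma)$ is the cubical complex of all elementary cubes $[i,j]\times[k,l]\subset[1,n]^2$ (so $j\in\{i,i+1\}$, $l\in\{k,k+1\}$) with $j\le k$ and $\{i,j,k,l\}\in\check{\mathrm C}_r(\Gamma)$. Both $\mathrm{DC}(\Gamma)$ and $\check{\mathrm C}(\Gamma)$ are filtered by $r$ via inclusions. Simplicial chains are spanned by oriented simplices $[v_0,\dots,v_k]$ (alternating in the vertices; a symbol with a repeated vertex is zero). For $1\le i\le j\le n$ put $c_\Gamma(i,j)=\sum_{k=i+1}^{j}[k-1,k]$. For $r>R_\Gamma$, the distance-to-Čech map $\psi_{\Gamma,r}\colon C_\bullet(\mathrm{DC}_r(\Gamma))\to C_{\bullet+1}(\check{\mathrm C}_r(\Gamma))$ is the degree-one chain map (homomorphisms $C_k\to C_{k+1}$ commuting with boundaries) that is the linear extension of: for a vertex $v=(i,j)=[i]\times[j]$, $\psi_{\Gamma,r}(v)=c_\Gamma(i,j)-[i,j]$; for edges, $\psi_{\Gamma,r}([i,i+1]\times[j])=[i,j,i+1]$ and $\psi_{\Gamma,r}([i]\times[j,j+1])=[i,j,j+1]$; for squares, $\psi_{\Gamma,r}([i,i+1]\times[j,j+1])=[i,i+1,j,j+1]$.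 It is compatible with the filtration inclusions, so the induced maps on homology form a morphism of persistence modules $H_k(\psi_\Gamma)\colon H_k(\mathrm{DC}(\Gamma))\to H_{k+1}(\check{\mathrm C}(\Gamma))$; its kernel, image and cokernel are formed pointwise in $r$. All these persistence modules are pointwise finite-dimensional; $\operatorname{Dgm}$ denotes the persistence diagram (the multiset of (birth, death) endpoints of the intervals in the barcode), and $d_B$ is the usual bottleneck distance between persistence diagrams. *)

(* Defs.v *)
From HB Require Import structures.
From mathcomp Require Import all_boot all_order all_algebra finmap.
From mathcomp Require Import all_classical all_reals all_analysis.

Set Implicit Arguments.
Unset Strict Implicit.
Unset Printing Implicit Defensive.
Import Order.TTheory GRing.Theory Num.Theory.
Local Open Scope ring_scope.

(* The quotient [V / U] is realized on the complement [U^C]; [qpi U] is the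
   canonical projection: it is onto, with kernel [U] ([limg_qpi], [lker_qpi]),
   and [qrep U] is a linear section of it. *)
Section Quotient.
Variables (K : fieldType) (V : vectType K) (U : {vspace V}).

Definition quot : vectType K := subvs_of (U^C)%VS.

Definition qpi : 'Hom(V, quot) :=
  (linfun (vsproj (U^C)%VS) \o (\1 - projv U))%VF.

Definition qrep : 'Hom(quot, V) := linfun (@vsval _ _ (U^C)%VS).

Lemma qrepK : cancel qrep qpi.
Proof.
move=> w; rewrite comp_lfunE add_lfunE opp_lfunE id_lfunE !lfunE /=.
have /eqP -> : projv U (vsval w) == 0 by rewrite -memv_ker lker_proj subvsP.
by rewrite subr0 vsvalK.
Qed.

Lemma limg_qpi : limg qpi = fullv.
Proof.
apply/vspaceP => w; rewrite memvf.
by apply/memv_imgP; exists (qrep w); rewrite ?memvf ?qrepK.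
Qed.

Lemma lker_qpi : lker qpi = U.
Proof.
apply/vspaceP => v; rewrite memv_ker comp_lfunE lfunE add_lfunE opp_lfunE.
rewrite id_lfunE; apply/eqP/idP => [/(congr1 vsval)|Uv].
  rewrite vsprojK ?memv_projC //= => /eqP.
  by rewrite subr_eq0 => /eqP ->; exact: memv_proj.
by rewrite projv_id // subrr linear0.
Qed.

Lemma qpiP v w : reflect (qpi v = qpi w) (v - w \in U).
Proof.
by rewrite -lker_qpi memv_ker linearB subr_eq0; exact: eqP.
Qed.

Lemma qrep_qpi v : v - qrep (qpi v) \in U.
Proof. by apply/qpiP; rewrite qrepK. Qed.

End Quotient.

(* Persistence modules indexed by the subset [D] of the line, pointwise
   finite-dimensional because their values are [vectType]s. The values of
   [pobj] and [pmap] at parameters outside [D] or in the wrong order carry no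
   information. *)
Record pmod (K : fieldType) (R : realType) (D : set R) := PMod {
  pobj :> R -> vectType K;
  pmap : forall s t, 'Hom(pobj s, pobj t);
  pmap_id : forall t, D t -> pmap t t = \1%VF;
  pmap_comp : forall s t u, D s -> D t -> D u -> s <= t -> t <= u ->
    (pmap t u \o pmap s t)%VF = pmap s u }.

Arguments pmap {K R D} _ s t.

Record pmor (K : fieldType) (R : realType) (D : set R) (M N : pmod K D) :=
  PMor {
  pfun :> forall t, 'Hom(M t, N t);
  pfunE : forall s t, D s -> D t -> s <= t ->
    (pmap N s t \o pfun s)%VF = (pfun t \o pmap M s t)%VF }.

Definition piso (K : fieldType) (R : realType) (D : set R) (M N : pmod K D) :=
  exists (f : pmor M N) (g : pmor N M), forall t, D t ->
    (g t \o f t)%VF = \1%VF /\ (f t \o g t)%VF = \1%VF.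

Section Constructions.
Variables (K : fieldType) (R : realType) (D : set R).
Implicit Types M N : pmod K D.

Definition stable M (Z : forall t, {vspace M t}) :=
  forall s t, D s -> D t -> s <= t -> (pmap M s t @: Z s <= Z t)%VS.

Section Sub.
Variables (M : pmod K D) (Z : forall t, {vspace M t}) (hZ : stable Z).

Definition psub_map s t : 'Hom(subvs_of (Z s), subvs_of (Z t)) :=
  (linfun (vsproj (Z t)) \o pmap M s t \o linfun (@vsval _ _ (Z s)))%VF.

Lemma psub_mapE s t w : D s -> D t -> s <= t ->
  vsval (psub_map s t w) = pmap M s t (vsval w).
Proof.
move=> Ds Dt st; rewrite !comp_lfunE !lfunE /= vsprojK //.
exact: (subvP (hZ Ds Dt st)) (memv_img _ (subvsP w)).
Qed.

Lemma psub_id t : D t -> psub_map t t = \1%VF.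
Proof.
move=> Dt; apply/lfunP => w; apply: subvs_inj.
by rewrite psub_mapE // pmap_id // !id_lfunE.
Qed.

Lemma psub_comp s t u : D s -> D t -> D u -> s <= t -> t <= u ->
  (psub_map t u \o psub_map s t)%VF = psub_map s u.
Proof.
move=> Ds Dt Du st tu; apply/lfunP => w; apply: subvs_inj.
rewrite comp_lfunE !psub_mapE ?(le_trans st) //.
by rewrite -(pmap_comp M Ds Dt Du st tu) comp_lfunE.
Qed.

Definition psub : pmod K D := PMod psub_id psub_comp.

End Sub.

Section Quo.
Variables (M : pmod K D) (B : forall t, {vspace M t}) (hB : stable B).

Definition pquot_map s t : 'Hom(quot (B s), quot (B t)) :=
  (qpi (B t) \o pmap M s t \o qrep (B s))%VF.

Lemma pquot_mapE s t v : D s -> D t -> s <= t ->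
  pquot_map s t (qpi (B s) v) = qpi (B t) (pmap M s t v).
Proof.
move=> Ds Dt st; rewrite /pquot_map 2!comp_lfunE.
apply/esym/qpiP; rewrite -linearB.
exact: (subvP (hB Ds Dt st)) (memv_img _ (qrep_qpi (B s) v)).
Qed.

Lemma pquot_id t : D t -> pquot_map t t = \1%VF.
Proof.
move=> Dt; apply/lfunP => w.
by rewrite -(qrepK w) pquot_mapE // pmap_id // !id_lfunE.
Qed.

Lemma pquot_comp s t u : D s -> D t -> D u -> s <= t -> t <= u ->
  (pquot_map t u \o pquot_map s t)%VF = pquot_map s u.
Proof.
move=> Ds Dt Du st tu; apply/lfunP => w.
rewrite comp_lfunE -(qrepK w) !pquot_mapE ?(le_trans st) //.
by rewrite -(pmap_comp M Ds Dt Du st tu) comp_lfunE.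
Qed.

Definition pquot : pmod K D := PMod pquot_id pquot_comp.

End Quo.

Section KerImCoker.
Variables (M N : pmod K D) (f : pmor M N).

Lemma pker_stable : @stable M (fun t => lker (f t)).
Proof.
move=> s t Ds Dt st; apply/subvP => _ /memv_imgP[v + ->].
rewrite !memv_ker -(comp_lfunE (f t)) -(pfunE f Ds Dt st) comp_lfunE.
by move=> /eqP ->; rewrite linear0.
Qed.

Lemma pim_stable : @stable N (fun t => limg (f t)).
Proof.
move=> s t Ds Dt st; apply/subvP => _ /memv_imgP[_ /memv_imgP[v _ ->] ->].
by rewrite -comp_lfunE (pfunE f Ds Dt st) comp_lfunE memv_img // memvf.
Qed.

Definition pker : pmod K D := psub pker_stable.
Definition pim : pmod K D := psub pim_stable.
Definition pcoker : pmod K D := pquot pim_stable.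

End KerImCoker.

End Constructions.

Inductive kic := Ker | Im | Coker.

Definition pkic (a : kic) (K : fieldType) (R : realType) (D : set R)
    (M N : pmod K D) (f : pmor M N) : pmod K D :=
  match a with Ker => pker f | Im => pim f | Coker => pcoker f end.

Record barcode (R : realType) (D : set R) := Barcode {
  bar_idx : choiceType;
  bar :> bar_idx -> set R;
  bar_sub : forall a, (bar a `<=` D)%classic;
  bar_nonempty : forall a, (bar a !=set0)%classic;
  bar_convex : forall a s t u, bar a s -> bar a u -> D t ->
    s <= t -> t <= u -> bar a t;
  bar_locally_finite : forall t, finite_set [set a | bar a t]%classic }.

(* The direct sum of the interval modules of a barcode: its value at [t] has as
   basis the set of bars containing [t], and its structure maps send a basis
   vector to itself if the bar is still alive and to 0 otherwise. *)
Section IntervalModules.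
Variables (K : fieldType) (R : realType) (D : set R) (B : barcode D).

Definition alive (t : R) : {fset bar_idx B} :=
  fset_set [set a | bar a t]%classic.

Lemma aliveP t a : reflect (bar a t) (a \in alive t).
Proof.
rewrite in_fset_set; last exact: bar_locally_finite.
by apply: (iffP idP); rewrite in_setE.
Qed.

Definition bars_obj (t : R) : vectType K := {ffun alive t -> K^o}.

Definition bars_fun (s t : R) (c : bars_obj s) : bars_obj t :=
  [ffun b : alive t => oapp c 0 (insub (val b))].

Lemma bars_fun_linear s t : linear (@bars_fun s t).
Proof.
move=> k c d; apply/ffunP => b; rewrite !ffunE.
by case: insubP => [a _ _|_] /=; rewrite ?ffunE // scaler0 addr0.
Qed.

HB.instance Definition _ s t :=
  @GRing.isLinear.Build K (bars_obj s) (bars_obj t) *:%R (@bars_fun s t)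
    (@bars_fun_linear s t).

Definition bars_map s t : 'Hom(bars_obj s, bars_obj t) :=
  linfun (@bars_fun s t).

Lemma bars_id t : D t -> bars_map t t = \1%VF.
Proof.
move=> _; apply/lfunP => c; rewrite lfunE id_lfunE /=; apply/ffunP => b.
by rewrite ffunE valK.
Qed.

Lemma bars_comp s t u : D s -> D t -> D u -> s <= t -> t <= u ->
  (bars_map t u \o bars_map s t)%VF = bars_map s u.
Proof.
move=> _ Dt _ st tu; apply/lfunP => c; rewrite comp_lfunE !lfunE /=.
apply/ffunP => b; rewrite !ffunE.
case: insubP => [a _ ab|nab] /=.
  by rewrite ffunE ab.
case: insubP => [a + _|//]; move/aliveP => bs; case/negP: nab; apply/aliveP.
by apply: bar_convex bs _ Dt st tu; apply/aliveP; exact: valP.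
Qed.

Definition bars_mod : pmod K D := PMod bars_id bars_comp.

End IntervalModules.

Definition is_barcode_of (K : fieldType) (R : realType) (D : set R)
  (M : pmod K D) (B : barcode D) := piso M (bars_mod K B).

(* A multiset of points of the extended plane, as an indexed family. *)
Record diagram (R : realType) := Diagram {
  dgm_idx : choiceType;
  dgm_pt :> dgm_idx -> \bar R * \bar R }.

Definition empty_diagram (R : realType) : diagram R :=
  @Diagram R void (fun v => match v with end).

Definition diagram_of (R : realType) (D : set R) (B : barcode D) : diagram R :=
  Diagram (fun a : bar_idx B =>
    (ereal_inf (EFin @` bar a)%classic, ereal_sup (EFin @` bar a)%classic)).

(* Every pointwise finite-dimensional persistence module over a totally ordered
   set has a barcode (Crawley-Boevey, Botnan), unique up to reindexing (Azumaya);
   so the default value is never used and the choice is immaterial. *)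
Definition Dgm (K : fieldType) (R : realType) (D : set R) (M : pmod K D) :
    diagram R :=
  match pselect (exists B, is_barcode_of M B) with
  | left h => diagram_of (projT1 (cid h))
  | right _ => empty_diagram R
  end.

Section Bottleneck.
Variable R : realType.
Local Open Scope ereal_scope.

(* The test gives [ext_dist +oo +oo = 0]. *)
Definition ext_dist (a b : \bar R) : \bar R :=
  if a == b then 0 else `|a - b|.

Definition sup_dist (p q : \bar R * \bar R) : \bar R :=
  maxe (ext_dist p.1 q.1) (ext_dist p.2 q.2).

(* the sup-distance of [p] to the diagonal *)
Definition diag_dist (p : \bar R * \bar R) : \bar R :=
  (p.2 - p.1) * (2^-1)%:E.

Definition partial_matching (P Q : diagram R)
    (m : dgm_idx P -> dgm_idx Q -> Prop) : Prop :=
  (forall i j j', m i j -> m i j' -> j = j') /\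
  (forall i i' j, m i j -> m i' j -> i = i').

Definition matching_cost (P Q : diagram R)
    (m : dgm_idx P -> dgm_idx Q -> Prop) : \bar R :=
  ereal_sup [set c | c = 0 \/
    (exists i j, m i j /\ c = sup_dist (P i) (Q j)) \/
    (exists i, (forall j, ~ m i j) /\ c = diag_dist (P i)) \/
    (exists j, (forall i, ~ m i j) /\ c = diag_dist (Q j))]%classic.

Definition bottleneck_dist (P Q : diagram R) : \bar R :=
  ereal_inf [set c | exists m, @partial_matching P Q m /\
                               c = matching_cost m]%classic.

End Bottleneck.

(* A filtered chain complex all of whose chain groups [fch t k] (parameter [t],
   degree [k]) are subspaces of one space, with inclusions as structure maps. *)
Record fcomplex (K : fieldType) (R : realType) (D : set R) := FComplex {
  fspace : vectType K;
  fbd : 'End(fspace);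
  fch : R -> nat -> {vspace fspace};
  fch_mono : forall s t k, D s -> D t -> s <= t -> (fch s k <= fch t k)%VS;
  fbd_sub : forall t k, D t -> (fbd @: fch t k.+1 <= fch t k)%VS;
  fbd0 : forall t, D t -> (fbd @: fch t 0 <= 0)%VS;
  fbd2 : forall t k c, D t -> c \in fch t k -> fbd (fbd c) = 0 }.

Arguments fbd {K R D} _.
Arguments fch {K R D} _ _ _.

Record fmap1 (K : fieldType) (R : realType) (D : set R) (C C' : fcomplex K D) :=
  FMap1 {
  ffn :> 'Hom(fspace C, fspace C');
  ffn_sub : forall t k, D t -> (ffn @: fch C t k <= fch C' t k.+1)%VS;
  ffn_bd : forall t k c, D t -> c \in fch C t k ->
    ffn (fbd C c) = fbd C' (ffn c) }.

Section Homology.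
Variables (K : fieldType) (R : realType) (D : set R).

Definition pconst (V : vectType K) : pmod K D :=
  @PMod K R D (fun=> V) (fun _ _ => \1%VF) (fun _ _ => erefl)
    (fun _ _ _ _ _ _ _ _ => comp_lfun1l _).

Section Object.
Variables (C : fcomplex K D) (k : nat).

Definition cycles (t : R) : {vspace pconst (fspace C) t} :=
  (fch C t k :&: lker (fbd C))%VS.

Lemma cycles_stable : stable cycles.
Proof.
move=> s t Ds Dt st; apply/subvP => _ /memv_imgP[v + ->].
rewrite id_lfunE /cycles !memv_cap => /andP[vs ->].
by rewrite (subvP (fch_mono C k Ds Dt st)).
Qed.

Definition pcycles : pmod K D := psub cycles_stable.

Definition boundaries (t : R) : {vspace pcycles t} :=
  (linfun (@vsval _ _ (cycles t)) @^-1: (fbd C @: fch C t k.+1))%VS.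

Lemma boundariesP t w :
  w \in boundaries t = (vsval w \in (fbd C @: fch C t k.+1)%VS).
Proof. by rewrite -memv_preim lfunE. Qed.

Lemma boundaries_stable : stable boundaries.
Proof.
move=> s t Ds Dt st; apply/subvP => _ /memv_imgP[v + ->].
rewrite !boundariesP (psub_mapE cycles_stable) // id_lfunE.
exact: (subvP (limgS _ (fch_mono C k.+1 Ds Dt st))).
Qed.

Definition homology : pmod K D := pquot boundaries_stable.

End Object.

Section Map.
Variables (C C' : fcomplex K D) (f : fmap1 C C') (k : nat).

Definition cycles_map t : 'Hom(pcycles C k t, pcycles C' k.+1 t) :=
  (linfun (vsproj (cycles C' k.+1 t)) \o f \o
   linfun (@vsval _ _ (cycles C k t)))%VF.

Lemma cycles_mapE t w : D t -> vsval (cycles_map t w) = f (vsval w).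
Proof.
move=> Dt; rewrite !comp_lfunE !lfunE /= vsprojK //.
have := subvsP w; rewrite /cycles !memv_cap !memv_ker => /andP[wC /eqP w0].
rewrite (subvP (ffn_sub f k Dt)) ?memv_img //=.
by rewrite -(ffn_bd f Dt wC) w0 linear0.
Qed.

Lemma cycles_map_boundaries t : D t ->
  (cycles_map t @: boundaries C k t <= boundaries C' k.+1 t)%VS.
Proof.
move=> Dt; apply/subvP => _ /memv_imgP[v + ->].
rewrite !boundariesP cycles_mapE // => /memv_imgP[c cC ->].
rewrite (ffn_bd f Dt cC) memv_img //.
by rewrite (subvP (ffn_sub f k.+1 Dt)) ?memv_img.
Qed.

Definition homology_fun t : 'Hom(homology C k t, homology C' k.+1 t) :=
  (qpi (boundaries C' k.+1 t) \o cycles_map t \o qrep (boundaries C k t))%VF.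

Lemma homology_funE t z : D t ->
  homology_fun t (qpi (boundaries C k t) z) =
  qpi (boundaries C' k.+1 t) (cycles_map t z).
Proof.
move=> Dt; rewrite /homology_fun 2!comp_lfunE.
apply/esym/qpiP; rewrite -linearB.
exact: (subvP (cycles_map_boundaries Dt)) (memv_img _ (qrep_qpi _ z)).
Qed.

Lemma homology_fun_natural s t : D s -> D t -> s <= t ->
  (pmap (homology C' k.+1) s t \o homology_fun s)%VF =
  (homology_fun t \o pmap (homology C k) s t)%VF.
Proof.
move=> Ds Dt st; apply/lfunP => w; rewrite comp_lfunE [RHS]comp_lfunE -(qrepK w).
rewrite homology_funE // !(pquot_mapE (@boundaries_stable _ _)) //.
rewrite homology_funE //; congr (qpi _ _); apply: subvs_inj.
by rewrite (psub_mapE (@cycles_stable _ _)) // !cycles_mapE //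
  (psub_mapE (@cycles_stable _ _)) // !id_lfunE.
Qed.

Definition homology_map : pmor (homology C k) (homology C' k.+1) :=
  PMor homology_fun_natural.

End Map.

End Homology.

Section Chains.
Variables (K : fieldType) (I : finType).

Definition delta (c : I) : {ffun I -> K^o} := [ffun d => (d == c)%:R].

Definition chain_span (P : pred I) : {vspace {ffun I -> K^o}} :=
  <<[seq delta c | c <- enum P]>>%VS.

Lemma mem_chain_span (P : pred I) c : P c -> delta c \in chain_span P.
Proof. by move=> Pc; apply/memv_span/map_f; rewrite mem_enum. Qed.

Lemma chain_span_sub (P : pred I) (U : {vspace {ffun I -> K^o}}) :
  (forall c, P c -> delta c \in U) -> (chain_span P <= U)%VS.
Proof.
move=> h; apply/span_subvP => _ /mapP[c + ->].
by rewrite mem_enum; exact: h.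
Qed.

Variables (V : vectType K) (f : I -> V).

Definition lin_ext_fun (c : {ffun I -> K^o}) : V := \sum_i c i *: f i.

Lemma lin_ext_fun_linear : linear lin_ext_fun.
Proof.
move=> k c d; rewrite /lin_ext_fun scaler_sumr -big_split.
by apply: eq_bigr => i _; rewrite !ffunE scalerDl scalerA.
Qed.

HB.instance Definition _ :=
  @GRing.isLinear.Build K {ffun I -> K^o} V *:%R lin_ext_fun lin_ext_fun_linear.

Definition lin_ext : 'Hom({ffun I -> K^o}, V) := linfun lin_ext_fun.

Lemma lin_extE c : lin_ext (delta c) = f c.
Proof.
rewrite lfunE /= /lin_ext_fun (bigD1 c) //= ffunE eqxx scale1r big1 ?addr0 //.
by move=> d /negbTE dc; rewrite ffunE dc scale0r.
Qed.

End Chains.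

Arguments delta {K I} c.
Arguments chain_span K {I} P.

Section Simplicial.
Variables (K : fieldType) (n : nat).

Definition simp_chain : vectType K := {ffun {set 'I_n} -> K^o}.

Fixpoint inversions (s : seq 'I_n) : nat :=
  if s is v :: s' then (count (fun u : 'I_n => u < v) s' + inversions s')%N
  else 0%N.

(* The oriented simplex [v_0, ..., v_k]; a basis vector [delta sigma] is the set
   [sigma] oriented by the order of its vertices. *)
Definition osimplex (s : seq 'I_n) : simp_chain :=
  if uniq s then (-1) ^+ inversions s *: delta [set:: s] else 0.

(* The exponent is the position of [v] in the increasing enumeration of
   [sigma]; the condition makes the boundary of a vertex zero. *)
Definition simp_bd_fun (sigma : {set 'I_n}) : simp_chain :=
  \sum_(v in sigma | sigma :\ v != finset.set0)
    (-1) ^+ #|[set u in sigma | (u < v)%N]%SET| *: delta (sigma :\ v).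

Definition simp_bd : 'End(simp_chain) := lin_ext simp_bd_fun.

Lemma simp_bd_delta (sigma : {set 'I_n}) :
  simp_bd (delta sigma) = simp_bd_fun sigma.
Proof. exact: lin_extE. Qed.

Let sgn (v : 'I_n) (sigma : {set 'I_n}) : K :=
  (-1) ^+ #|[set u in sigma | (u < v)%N]%SET|.

Lemma sgn_rem_lt (u v : 'I_n) (sigma : {set 'I_n}) : u \in sigma -> (u < v)%N ->
  sgn v sigma = - sgn v (sigma :\ u).
Proof.
move=> us uv; rewrite /sgn (cardsD1 u) inE us uv /= exprS mulN1r.
congr (- (_ ^+ _)); apply: eq_card => w; rewrite !inE.
by rewrite andbA.
Qed.

Lemma sgn_rem_ge (u v : 'I_n) (sigma : {set 'I_n}) : (v <= u)%N ->
  sgn v (sigma :\ u) = sgn v sigma.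
Proof.
move=> vu; congr (_ ^+ _); apply: eq_card => w; rewrite !inE.
by case: (eqVneq w u) => [->|] //=; rewrite ltnNge vu andbF.
Qed.

Lemma simp_bd_bd (sigma : {set 'I_n}) : simp_bd (simp_bd (delta sigma)) = 0.
Proof.
pose P (p : 'I_n * 'I_n) := [&& p.1 \in sigma, p.2 \in sigma, p.1 != p.2 &
  sigma :\ p.1 :\ p.2 != finset.set0].
pose a (p : 'I_n * 'I_n) := (sgn p.1 sigma * sgn p.2 (sigma :\ p.1)) *:
  (delta (sigma :\ p.1 :\ p.2) : simp_chain).
transitivity (\sum_(p | P p) a p).
  rewrite simp_bd_delta linear_sum /=.
  rewrite (eq_bigr (fun v => \sum_(u in sigma :\ v | sigma :\ v :\ u != finset.set0)
    a (v, u))); last first.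
    move=> v _; rewrite linearZ /= simp_bd_delta scaler_sumr.
    by apply: eq_bigr => u _; rewrite scalerA.
  rewrite pair_big_dep; apply: eq_big => [[v u]|[]//].
  rewrite /P /= !inE (eq_sym u v); case: (v \in sigma) => //=.
  case: (u \in sigma); rewrite ?andbF //= andbT.
  case: (v != u); rewrite ?andbF //=.
  case: (eqVneq (sigma :\ v) finset.set0) => [->|//].
  by rewrite finset.set0D eqxx.
rewrite (bigID (fun p : 'I_n * 'I_n => (p.1 < p.2)%N)) /=.
rewrite (reindex_inj (h := fun p : 'I_n * 'I_n => (p.2, p.1))) /=; last first.
  by move=> [? ?] [? ?] [-> ->].
rewrite (eq_bigl (fun p : 'I_n * 'I_n => P p && ~~ (p.1 < p.2)%N)) /=; last first.
  move=> [v u]; rewrite /P /= (eq_sym u v) finset.setDDl finset.setUC -finset.setDDl.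
  case: (v \in sigma); case: (u \in sigma) => //=.
  case: (eqVneq v u) => //= vu; congr (_ && _).
  by move: vu; rewrite -val_eqE /=; case: ltngtP.
rewrite -big_split big1 //= => -[v u] /andP[/and4P[/= vs us vu _]].
rewrite -leqNgt => uv; rewrite /a /=.
have {}uv : (u < v)%N by move: vu uv; rewrite -val_eqE /=; case: ltngtP.
rewrite (sgn_rem_lt us uv) (sgn_rem_ge _ (ltnW uv)).
rewrite finset.setDDl finset.setUC -finset.setDDl.
by rewrite mulNr scaleNr mulrC subrr.
Qed.

Lemma simp_bd_seq (s : seq 'I_n) : uniq s -> (1 < size s)%N ->
  simp_bd (delta [set:: s]) =
  \sum_(v <- s) (-1) ^+ count (fun u : 'I_n => u < v)%N s *:
     (delta [set:: [seq u <- s | u != v]] : simp_chain).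
Proof.
move=> us ss; rewrite simp_bd_delta (bigop.big_uniq _ us) /=.
apply: eq_big => [v|v /andP[vs _]].
  rewrite inE; case vs : (v \in s) => //=.
  apply/set0Pn; have : (0 < size ([seq u <- s | u != v]))%N.
    by rewrite -rem_filter // size_rem // -subn1 subn_gt0.
  rewrite -has_predT => /hasP[u]; rewrite mem_filter => /andP[/= uv us'] _.
  by exists u; rewrite !inE uv us'.
congr (_ ^+ _ *: delta _).
  rewrite -size_filter -(card_uniqP (filter_uniq _ us)).
  by apply: eq_card => u; rewrite !inE mem_filter andbC.
by apply/setP => u; rewrite !inE mem_filter.
Qed.

Lemma osimplex1 (a : 'I_n) : osimplex [:: a] = delta [set a].
Proof.
rewrite /osimplex /= expr0 scale1r; congr delta.
by apply/setP => u; rewrite !inE.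
Qed.

Let lt_neq (a b : 'I_n) : (a < b)%N -> ((a == b) = false) * ((b == a) = false).
Proof.
by move=> ab; rewrite -!val_eqE (ltn_eqF ab) (gtn_eqF ab).
Qed.

Let lt_dec (a b : 'I_n) : (a < b)%N ->
  ((a == b) = false) * ((b == a) = false) * ((a < b)%N = true) *
  ((b < a)%N = false).
Proof. by move=> ab; do !split; rewrite ?(lt_neq ab) // ltnNge ltnW. Qed.

Lemma osimplex_sorted (s : seq 'I_n) :
  sorted (fun a b : 'I_n => a < b)%N s -> osimplex s = delta [set:: s].
Proof.
move=> ss; have tr : transitive (fun a b : 'I_n => a < b)%N.
  by move=> b a c; exact: ltn_trans.
rewrite /osimplex (sorted_uniq tr) // ?(fun=> ltnn) //; last first.
  by move=> a; rewrite ltnn.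
suff -> : inversions s = 0%N by rewrite expr0 scale1r.
elim: s ss => //= a s IH ss; rewrite IH ?(path_sorted ss) // addn0.
apply/eqP; rewrite -leqn0 leqNgt -has_count; apply/hasPn => b bs.
by rewrite -leqNgt ltnW //; move/allP: (order_path_min tr ss) => /(_ _ bs).
Qed.

Lemma bd_osimplex2 (a b : 'I_n) : (a <= b)%N ->
  simp_bd (osimplex [:: a; b]) = osimplex [:: b] - osimplex [:: a].
Proof.
rewrite leq_eqVlt => /orP[/eqP/val_inj ->|ab].
  by rewrite /osimplex /= inE eqxx /= linear0 subrr.
rewrite !osimplex_sorted /= ?ab // simp_bd_seq //=; last first.
  by rewrite inE !(lt_dec ab).
rewrite !big_cons big_nil /= !(lt_dec ab) !eqxx !ltnn /=.
by rewrite !add0n addn0 expr0 expr1 scale1r scaleN1r addr0.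
Qed.

Lemma bd_osimplex3 (a b c : 'I_n) : (a < b)%N -> (b < c)%N ->
  simp_bd (osimplex [:: a; b; c]) =
  osimplex [:: b; c] - osimplex [:: a; c] + osimplex [:: a; b].
Proof.
move=> ab bc; have ac := ltn_trans ab bc.
rewrite !osimplex_sorted /= ?ab ?bc ?ac // simp_bd_seq //=; last first.
  by rewrite !inE !(lt_dec ab) !(lt_dec bc) !(lt_dec ac).
rewrite !big_cons big_nil /= !(lt_dec ab) !(lt_dec bc) !(lt_dec ac).
rewrite !eqxx !ltnn /= !add0n ?addn0 expr0 expr1 sqrrN expr1n.
by rewrite !scale1r scaleN1r addr0 addrA.
Qed.

Lemma bd_osimplex4 (a b c d : 'I_n) : (a < b)%N -> (b < c)%N -> (c < d)%N ->
  simp_bd (osimplex [:: a; b; c; d]) =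
  osimplex [:: b; c; d] - osimplex [:: a; c; d] + osimplex [:: a; b; d]
  - osimplex [:: a; b; c].
Proof.
move=> ab bc cd; have ac := ltn_trans ab bc; have bd := ltn_trans bc cd.
have ad := ltn_trans ab bd.
rewrite !osimplex_sorted /= ?ab ?bc ?ac ?bd ?ad ?cd // simp_bd_seq //=; last first.
  by rewrite !inE !(lt_dec ab) !(lt_dec bc) !(lt_dec ac) !(lt_dec bd)
    !(lt_dec ad) !(lt_dec cd).
rewrite !big_cons big_nil /= !(lt_dec ab) !(lt_dec bc) !(lt_dec ac).
rewrite !(lt_dec bd) !(lt_dec ad) !(lt_dec cd).
rewrite !eqxx !ltnn /= !add0n ?addn0 expr0 expr1 sqrrN expr1n.
rewrite exprS sqrrN expr1n mulr1.
by rewrite !scale1r !scaleN1r addr0 !addrA.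
Qed.

Lemma osimplex_swap23 (a b c : 'I_n) : (a < b)%N -> (b <= c)%N ->
  osimplex [:: a; c; b] = - osimplex [:: a; b; c].
Proof.
move=> ab; rewrite leq_eqVlt => /orP[/eqP/val_inj <-|bc].
  by rewrite /osimplex /= !inE eqxx /= andbF oppr0.
have ac := ltn_trans ab bc.
rewrite /osimplex /= !inE !(lt_dec ab) !(lt_dec bc) !(lt_dec ac) /=.
rewrite expr0 expr1 scale1r scaleN1r; congr (- delta _).
by apply/setP => u; rewrite !inE; do 3 case: eqP.
Qed.

Lemma osimplex_swap2 (a b : 'I_n) : (a <= b)%N ->
  osimplex [:: b; a] = - osimplex [:: a; b].
Proof.
rewrite leq_eqVlt => /orP[/eqP/val_inj <-|ab].
  by rewrite /osimplex /= !inE eqxx oppr0.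
rewrite /osimplex /= !inE !(lt_dec ab) /=.
rewrite expr0 expr1 scale1r scaleN1r; congr (- delta _).
by apply/setP => u; rewrite !inE; do 2 case: eqP.
Qed.

(* the chain [c(i,j)], zero unless [i < j] *)
Definition path_chain (i j : 'I_n) : simp_chain :=
  \sum_(p : 'I_n * 'I_n | [&& (i <= p.1)%N, p.2 == p.1.+1 :> nat & (p.2 <= j)%N])
    osimplex [:: p.1; p.2].

Lemma path_chain_id i : path_chain i i = 0.
Proof.
apply: big1 => -[p q] /= /and3P[ip /eqP -> pi].
by move: (leq_trans pi ip); rewrite ltnn.
Qed.

Lemma path_chainS (i k l : 'I_n) : (i <= k)%N -> l = k.+1 :> nat ->
  path_chain i l = path_chain i k + osimplex [:: k; l].
Proof.
move=> ik lk; rewrite /path_chain (bigD1 (k, l)) /=; last first.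
  by rewrite ik lk eqxx leqnn.
rewrite addrC; congr (_ + _); apply: eq_bigl => -[p q] /=.
rewrite xpair_eqE -!val_eqE /= lk; case: (eqVneq (q : nat) p.+1) => [->|]; last first.
  by rewrite !andbF.
rewrite ?eqxx /= eqSS andbb ltnS -andbA; congr (_ && _).
by rewrite andbC -ltn_neqAle.
Qed.

Lemma path_chain_pre (i i' k : 'I_n) : i' = i.+1 :> nat -> (i' <= k)%N ->
  path_chain i k = osimplex [:: i; i'] + path_chain i' k.
Proof.
move=> ii ik; rewrite /path_chain (bigD1 (i, i')) /=; last first.
  by rewrite leqnn ii eqxx -ii ik.
congr (_ + _); apply: eq_bigl => -[p q] /=.
rewrite xpair_eqE -!val_eqE /= ii; case: (eqVneq (q : nat) p.+1) => [->|]; last first.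
  by rewrite !andbF.
rewrite ?eqxx /= eqSS andbb [in RHS]ltn_neqAle (eq_sym (i : nat)).
by rewrite andbC andbA.
Qed.

Lemma bd_path_chain (i j : 'I_n) : (i <= j)%N ->
  simp_bd (path_chain i j) = osimplex [:: j] - osimplex [:: i].
Proof.
move: {2}(j : nat) (erefl (j : nat)) => m; elim: m j => [|m IH] j jm ij.
  have -> : i = j by apply: val_inj; move: ij; rewrite /= jm leqn0 => /eqP.
  by rewrite path_chain_id linear0 subrr.
move: ij; rewrite leq_eqVlt => /orP[/eqP/val_inj ->|ij].
  by rewrite path_chain_id linear0 subrr.
have mn : (m < n)%N by apply: ltn_trans (ltn_ord j); rewrite jm.
have im : (i <= Ordinal mn)%N by rewrite -ltnS -jm.
rewrite (path_chainS im jm) linearD /= (IH (Ordinal mn) erefl im).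
by rewrite bd_osimplex2 /= ?jm // addrC addrA subrK.
Qed.

End Simplicial.

Arguments osimplex K {n} s.

Section ZmodIdentities.
Variable V : zmodType.

Fact zmod_id1 (a b d e : V) : a - b - (d - e) - (a - d) + (b - e) = 0.
Proof.
rewrite !opprB !addrA subrK (addrAC _ e (- a)) (addrAC a) subrr add0r.
by rewrite (addrAC (- b)) addNr add0r subrr.
Qed.

Fact zmod_id2 (c p q r : V) : c + p - q - (c - r) = p - q + r.
Proof.
by rewrite opprB [r - c]addrC addrA -(addrA c) [c + _ - c]addrC addKr.
Qed.

Fact zmod_id3 (x p q r : V) : x - p - (q + x - r) = - (p - r + q).
Proof.
rewrite !opprD !opprK [x - p]addrC -!addrA; congr (- p + _).
by rewrite !addrA (addrAC x) subrr add0r addrC.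
Qed.

End ZmodIdentities.

(* A point cloud of length [n] is a family indexed by [0, ..., n-1]. *)

Definition above (R : realType) (a : R) : set R := [set r | a < r]%classic.

Section PointClouds.
Variables (R : realType) (X : metricType R) (n : nat).
Implicit Types (x : 'I_n -> X) (r : R).

Definition balls_meet (x : 'I_n -> X) (r : R) (i j : 'I_n) :=
  (ball (x i) r `&` ball (x j) r !=set0)%classic.

Definition sample_radius (x : 'I_n -> X) : R :=
  inf [set r | 0 <= r /\
    forall i j : 'I_n, j = i.+1 :> nat -> balls_meet x r i j]%classic.

Definition dinfty (x x' : 'I_n -> X) : R :=
  \big[Num.max/0]_(i < n) mdist (x i) (x' i).

Definition cech (x : 'I_n -> X) (r : R) : pred {set 'I_n} := fun sigma =>
  (sigma != finset.set0) &&
  `[< (\bigcap_(i in [set` sigma]) ball (x i) r !=set0)%classic >].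

Lemma cechP x r (sigma : {set 'I_n}) :
  reflect (sigma != finset.set0 /\ exists y, forall i, i \in sigma -> ball (x i) r y)
    (cech x r sigma).
Proof.
apply: (iffP andP) => [[s0 /asboolP[y hy]]|[s0 [y hy]]]; split=> //.
  by exists y => i; exact: hy.
by apply/asboolP; exists y => i; exact: hy.
Qed.

Lemma cech_le x r r' sigma : r <= r' -> cech x r sigma -> cech x r' sigma.
Proof.
move=> rr /cechP[s0 [y hy]]; apply/cechP; split => //; exists y => i /hy.
exact: le_ball.
Qed.

Lemma cech_sub x r (sigma tau : {set 'I_n}) : tau != finset.set0 ->
  tau \subset sigma -> cech x r sigma -> cech x r tau.
Proof.
move=> t0 ts /cechP[_ [y hy]]; apply/cechP; split=> //; exists y => i it.
by apply: hy; exact: (fintype.subsetP ts).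
Qed.

Lemma balls_meet_cech x r i j : balls_meet x r i j -> cech x r [set i; j]%SET.
Proof.
move=> [y [yi yj]]; apply/cechP; split.
  by apply/set0Pn; exists i; rewrite !inE eqxx.
by exists y => k; rewrite !inE => /orP[/eqP ->|/eqP ->].
Qed.

Lemma sample_radius_lt x r : sample_radius x < r ->
  forall i j : 'I_n, j = i.+1 :> nat -> balls_meet x r i j.
Proof.
rewrite /sample_radius; set S := (X in inf X).
have S0 : (S !=set0)%classic.
  pose r0 := 1 + \sum_(i < n) \sum_(j < n) mdist (x i) (x j).
  have ge0 i : 0 <= \sum_(j < n) mdist (x i) (x j).
    by apply: sumr_ge0 => j _; exact: mdist_ge0.
  have r00 : 0 < r0 by rewrite ltr_pwDl ?sumr_ge0.
  exists r0; split=> [|i j _]; first exact: ltW.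
  exists (x j); split; rewrite ballEmdist /= ?mdistxx //.
  apply: le_lt_trans (_ : _ <= \sum_(i < n) \sum_(j < n) mdist (x i) (x j)) _.
    rewrite (bigD1 i) //= (bigD1 j) //= -addrA lerDl addr_ge0 //.
      by apply: sumr_ge0 => k _; exact: mdist_ge0.
    by apply: sumr_ge0 => k _; exact: ge0.
  by rewrite ltrDr.
move=> /(inf_lt S0)[r' [_ hr'] r'r] i j /hr'[y [yi yj]].
by exists y; split; apply: le_ball (ltW r'r) _ _.
Qed.

Section Cech.
Variables (K : fieldType) (D : set R) (x : 'I_n -> X).

Definition cech_ch (r : R) (k : nat) : {vspace simp_chain K n} :=
  chain_span K (fun sigma => cech x r sigma && (#|sigma| == k.+1)).

Lemma cech_mono s t k : D s -> D t -> s <= t -> (cech_ch s k <= cech_ch t k)%VS.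
Proof.
move=> _ _ st; apply: chain_span_sub => sigma /andP[cs sk].
by apply: mem_chain_span; rewrite sk (cech_le st cs).
Qed.

Lemma cech_bd_sub t k : D t ->
  (simp_bd K n @: cech_ch t k.+1 <= cech_ch t k)%VS.
Proof.
move=> _; rewrite limg_span -map_comp; apply/span_subvP => _ /mapP[sigma + ->].
rewrite mem_enum => /andP[cs sk] /=; rewrite simp_bd_delta.
apply: memv_suml => v /andP[vs s0]; apply: memvZ; apply: mem_chain_span.
rewrite (cech_sub s0 _ cs) ?subD1set //=.
by move: sk; rewrite (cardsD1 v) vs.
Qed.

Lemma cech_bd0 t : D t -> (simp_bd K n @: cech_ch t 0 <= 0)%VS.
Proof.
move=> _; rewrite limg_span -map_comp; apply/span_subvP => _ /mapP[sigma + ->].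
rewrite mem_enum => /andP[cs sk] /=; rewrite simp_bd_delta memv0.
apply/eqP; apply: big1 => v /andP[vs]; rewrite -card_gt0.
by move: sk; rewrite (cardsD1 v) vs eqSS => /eqP ->.
Qed.

Lemma cech_bd2 t k c : D t -> c \in cech_ch t k ->
  simp_bd K n (simp_bd K n c) = 0.
Proof.
move=> _ cC; apply/eqP; rewrite -comp_lfunE -memv_ker.
apply: (subvP _ _ cC); apply: chain_span_sub => sigma _.
by rewrite memv_ker comp_lfunE simp_bd_bd.
Qed.

Definition cech_complex : fcomplex K D :=
  FComplex cech_mono cech_bd_sub cech_bd0 cech_bd2.

End Cech.

(* [((i, j), (k, l))] stands for [[i,j] x [k,l]]; it is an elementary cube when
   [is_cube] holds. *)
Definition cube : finType := (('I_n * 'I_n) * ('I_n * 'I_n))%type.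

Definition is_itv (p : 'I_n * 'I_n) :=
  (p.2 == p.1 :> nat) || (p.2 == p.1.+1 :> nat).

Definition is_cube (c : cube) := is_itv c.1 && is_itv c.2.

Definition cube_dim (c : cube) : nat :=
  ((c.1.1 != c.1.2) + (c.2.1 != c.2.2))%N.

Definition dc (x : 'I_n -> X) (r : R) : pred cube := fun c =>
  [&& is_cube c, (c.1.2 <= c.2.1)%N &
      cech x r [set c.1.1; c.1.2; c.2.1; c.2.2]%SET].

Section Distance.
Variable K : fieldType.

Definition cube_chain : vectType K := {ffun cube -> K^o}.

Definition cube_bd_fun (c : cube) : cube_chain :=
  let: ((i, i'), (j, j')) := c in
  match i == i', j == j' with
  | true, true => 0
  | true, false => delta ((i, i), (j', j')) - delta ((i, i), (j, j))
  | false, true => delta ((i', i'), (j, j)) - delta ((i, i), (j, j))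
  | false, false => delta ((i', i'), (j, j')) - delta ((i, i), (j, j'))
                  - delta ((i, i'), (j', j')) + delta ((i, i'), (j, j))
  end.

Definition cube_bd : 'End(cube_chain) := lin_ext cube_bd_fun.

(* Since [i <= i' <= j <= j'] in the distance complex, [i == i'] and [j == j']
   distinguish vertices, edges and squares. *)
Definition psi_fun (c : cube) : simp_chain K n :=
  let: ((i, i'), (j, j')) := c in
  match i == i', j == j' with
  | true, true => path_chain K i j - osimplex K [:: i; j]
  | true, false => osimplex K [:: i; j; j']
  | false, true => osimplex K [:: i; j; i']
  | false, false => osimplex K [:: i; i'; j; j']
  end.

Definition psi : 'Hom(cube_chain, simp_chain K n) := lin_ext psi_fun.

Lemma cube_bdE (c : cube) : cube_bd (delta c) = cube_bd_fun c.
Proof. exact: lin_extE. Qed.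

Lemma psiE (c : cube) : psi (delta c) = psi_fun c.
Proof. exact: lin_extE. Qed.

Section Complex.
Variables (D : set R) (x : 'I_n -> X).

Definition dc_ch (r : R) (k : nat) : {vspace cube_chain} :=
  chain_span K (fun c => dc x r c && (cube_dim c == k)).

Lemma dc_mono s t k : D s -> D t -> s <= t -> (dc_ch s k <= dc_ch t k)%VS.
Proof.
move=> _ _ st; apply: chain_span_sub => c /andP[/and3P[cc ij cs] sk].
by apply: mem_chain_span; rewrite sk /dc cc ij (cech_le st cs).
Qed.

Lemma dc_face t (i i' j j' p p' q q' : 'I_n) : dc x t ((i, i'), (j, j')) ->
  is_itv (p, p') -> is_itv (q, q') -> p \in [:: i; i'] -> p' \in [:: i; i'] ->
  q \in [:: j; j'] -> q' \in [:: j; j'] -> dc x t ((p, p'), (q, q')).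
Proof.
move=> /and3P[/andP[/= ci cj] ij cs] cp cq pi pi' qj qj'.
have le_itv (a b : 'I_n) : is_itv (a, b) -> (a <= b)%N.
  by move=> /orP[]/eqP /= ->.
apply/and3P; split; first by rewrite /is_cube cp.
  move: pi' qj (le_itv _ _ ci) (le_itv _ _ cj); rewrite !inE /=.
  move=> /orP[]/eqP -> /orP[]/eqP -> h h' //=.
  - exact: leq_trans h _.
  - exact: leq_trans h (leq_trans ij h').
  - exact: leq_trans ij h'.
apply: cech_sub cs; first by apply/set0Pn; exists p; rewrite !inE eqxx.
apply/fintype.subsetP => u; rewrite !inE -!orbA => /or4P[]/eqP ->.
- by move: pi; rewrite !inE => /orP[] ->; rewrite ?orbT.
- by move: pi'; rewrite !inE => /orP[] ->; rewrite ?orbT.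
- by move: qj; rewrite !inE => /orP[] ->; rewrite ?orbT.
- by move: qj'; rewrite !inE => /orP[] ->; rewrite ?orbT.
Qed.

Lemma dc_bd_sub t k : D t -> (cube_bd @: dc_ch t k.+1 <= dc_ch t k)%VS.
Proof.
move=> _; rewrite limg_span -map_comp; apply/span_subvP => _ /mapP[c + ->].
rewrite mem_enum; case: c => [[i i'] [j j']] /andP[cs sk] /=.
have [/andP[/= ci cj] _ _] := and3P cs.
have itv a : is_itv (a, a) by rewrite /is_itv eqxx.
rewrite cube_bdE; move: sk; rewrite /cube_bd_fun /cube_dim /=.
have face p p' q q' : is_itv (p, p') -> is_itv (q, q') ->
  p \in [:: i; i'] -> p' \in [:: i; i'] -> q \in [:: j; j'] -> q' \in [:: j; j'] ->
  ((p != p') + (q != q'))%N = k -> (delta (((p, p'), (q, q')) : cube) : cube_chain) \in dc_ch t k.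
  move=> *; apply: mem_chain_span; rewrite /cube_dim /=.
  by apply/andP; split; [exact: (dc_face cs) | exact/eqP].
case: (eqVneq i i') => [ii|ii]; case: (eqVneq j j') => [jj|jj] //= /eqP[k0];
  do ?[apply: memvB | apply: memvD]; apply: face;
  by rewrite ?inE ?eqxx ?orbT ?itv // ?ii ?jj.
Qed.

Lemma dc_bd0 t : D t -> (cube_bd @: dc_ch t 0 <= 0)%VS.
Proof.
move=> _; rewrite limg_span -map_comp; apply/span_subvP => _ /mapP[c + ->].
rewrite mem_enum; case: c => [[i i'] [j j']] /andP[cs sk] /=.
rewrite cube_bdE memv0; move: sk; rewrite /cube_bd_fun /cube_dim /=.
by case: (i == i'); case: (j == j').
Qed.

Lemma dc_bd2 t k c : D t -> c \in dc_ch t k -> cube_bd (cube_bd c) = 0.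
Proof.
move=> _ cC; apply/eqP; rewrite -comp_lfunE -memv_ker.
apply: (subvP _ _ cC); apply: chain_span_sub => {cC}c _.
rewrite memv_ker comp_lfunE cube_bdE; case: c => [[i i'] [j j']].
apply/eqP; rewrite [in cube_bd _]/cube_bd_fun.
case: (eqVneq i i') => ii; case: (eqVneq j j') => jj.
- exact: linear0.
- by rewrite linearB /= !cube_bdE /cube_bd_fun !eqxx subrr.
- by rewrite linearB /= !cube_bdE /cube_bd_fun !eqxx subrr.
rewrite linearD !linearB /= !cube_bdE /cube_bd_fun !eqxx (negbTE ii) (negbTE jj).
set a := delta _; set b := delta _; set d := delta _; set e := delta _.
exact: zmod_id1.
Qed.

Definition dc_complex : fcomplex K D :=
  FComplex dc_mono dc_bd_sub dc_bd0 dc_bd2.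

End Complex.

Section Psi.
Variables (x : 'I_n -> X) (a : R) (ha : sample_radius x <= a).

Let ray : set R := above a.

Lemma cech_osimplex t (s : seq 'I_n) k : cech x t [set:: s] ->
  size s = k.+1 -> osimplex K s \in cech_ch K x t k.
Proof.
move=> cs sk; rewrite /osimplex; case: ifP => [us|_]; last exact: mem0v.
apply: memvZ; apply: mem_chain_span; rewrite cs /=.
by rewrite cardsE (card_uniqP us) sk.
Qed.

Lemma psi_sub t k : ray t ->
  (psi @: fch (dc_complex ray x) t k <= fch (cech_complex K ray x) t k.+1)%VS.
Proof.
move=> at_; rewrite limg_span -map_comp; apply/span_subvP => _ /mapP[c + ->].
rewrite mem_enum; case: c => [[i i'] [j j']] /andP[cs sk] /=.
have {}cs : cech x t [set i; i'; j; j']%SET by case/and3P: cs.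
have simp s : (0 < size s)%N -> {subset s <= [:: i; i'; j; j']} -> size s = k.+2 ->
    osimplex K s \in cech_ch K x t k.+1.
  move=> s0 ss sz; apply: cech_osimplex => //; apply: cech_sub cs.
    by case: s s0 {ss sz} => // u s _; apply/set0Pn; exists u; rewrite !inE eqxx.
  by apply/fintype.subsetP => u; rewrite inE => /ss; rewrite !inE !orbA.
rewrite psiE; move: sk; rewrite /psi_fun /cube_dim /=.
case: (eqVneq i i') => ii; case: (eqVneq j j') => jj /= /eqP k0.
- apply: memvB; last first.
    apply: simp; rewrite -?k0 // => u; rewrite !inE.
    by case/orP => ->; rewrite ?orbT.
  apply: memv_suml => -[p q] /= /and3P[_ /eqP pq _].
  apply: cech_osimplex; last by rewrite -k0.
  have := balls_meet_cech (sample_radius_lt (le_lt_trans ha at_) pq).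
  suff -> : [set:: [:: p; q]] = [set p; q]%SET by [].
  by apply/setP => u; rewrite !inE.
- apply: simp; rewrite -?k0 // => u; rewrite !inE.
  by case/or3P => ->; rewrite ?orbT.
- apply: simp; rewrite -?k0 // => u; rewrite !inE.
  by case/or3P => ->; rewrite ?orbT.
- by apply: simp; rewrite -?k0.
Qed.

Lemma psi_bd_delta (i i' j j' : 'I_n) :
  is_itv (i, i') -> is_itv (j, j') -> (i' <= j)%N ->
  psi (cube_bd (delta ((i, i'), (j, j')))) =
  simp_bd K n (psi (delta ((i, i'), (j, j')))).
Proof.
have succ (p q : 'I_n) : is_itv (p, q) -> p != q -> q = p.+1 :> nat.
  by rewrite /is_itv /= -val_eqE eq_sym /=; case: (eqVneq (q : nat) p) => //= _ /eqP.
move=> ci cj ij; rewrite cube_bdE psiE /cube_bd_fun /psi_fun.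
have rep2 (p : 'I_n) : osimplex K [:: p; p] = 0.
  by rewrite /osimplex /= inE eqxx.
have rep3r (p q : 'I_n) : osimplex K [:: p; q; q] = 0.
  by rewrite /osimplex /= !inE eqxx /= andbF.
have rep3l (p q : 'I_n) : osimplex K [:: p; p; q] = 0.
  by rewrite /osimplex /= !inE eqxx.
have rep4 (p q s : 'I_n) : osimplex K [:: p; q; q; s] = 0.
  by rewrite /osimplex /= !inE eqxx /= andbF.
case: (eqVneq i i') => [ii|ni]; case: (eqVneq j j') => [jj|nj].
- rewrite linear0 linearB /=; subst i' j'.
  by rewrite bd_path_chain // bd_osimplex2 // subrr.
- have ej := succ _ _ cj nj; subst i'.
  rewrite linearB /= !psiE /psi_fun !eqxx (path_chainS K ij ej).
  have jj' : (j < j')%N by rewrite ej.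
  rewrite zmod_id2; move: ij; rewrite leq_eqVlt => /orP[/eqP/val_inj ->|ij].
    by rewrite rep2 rep3l linear0 subrr addr0.
  by rewrite bd_osimplex3.
- have ei := succ _ _ ci ni; subst j'.
  rewrite linearB /= !psiE /psi_fun !eqxx (path_chain_pre K ei ij) zmod_id3.
  have ii' : (i < i')%N by rewrite ei.
  rewrite osimplex_swap23 // linearN /=; congr (- _).
  move: ij; rewrite leq_eqVlt => /orP[/eqP/val_inj ->|ij].
    by rewrite rep2 rep3r linear0 sub0r addNr.
  by rewrite bd_osimplex3.
- have ei := succ _ _ ci ni; have ej := succ _ _ cj nj.
  have ii' : (i < i')%N by rewrite ei.
  have jj' : (j < j')%N by rewrite ej.
  rewrite linearD !linearB /= !psiE /psi_fun !eqxx (negbTE ni) (negbTE nj).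
  rewrite !(osimplex_swap23 _ ii') ?(leq_trans ij (ltnW jj')) // opprK.
  move: ij; rewrite leq_eqVlt => /orP[/eqP/val_inj ->|ij].
    by rewrite rep3l rep3r rep4 !linear0 sub0r addr0 addNr.
  by rewrite bd_osimplex4.
Qed.

Lemma psi_bd t k c : ray t -> c \in fch (dc_complex ray x) t k ->
  psi (fbd (dc_complex ray x) c) = fbd (cech_complex K ray x) (psi c).
Proof.
move=> _ cC /=; rewrite -!comp_lfunE; apply/eqlfunP.
apply: (subvP _ _ cC); apply: chain_span_sub => -[[i i'] [j j']] {c cC}.
move=> /andP[/and3P[/andP[/= ci cj] ij _] _]; apply/eqlfunP.
by rewrite !comp_lfunE psi_bd_delta.
Qed.

Definition psi_map :
    fmap1 (dc_complex (above a) x) (cech_complex K (above a) x) :=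
  @FMap1 K R ray (dc_complex ray x) (cech_complex K ray x) psi psi_sub psi_bd.

(* [H_k(psi)], as a morphism of persistence modules indexed by [r > a]; the
   hypothesis [sample_radius x <= a] makes [psi] a chain map at these [r]. *)
Definition Hpsi (k : nat) :
    pmor (homology (dc_complex (above a) x) k)
         (homology (cech_complex K (above a) x) k.+1) :=
  homology_map psi_map k.

End Psi.

End Distance.

End PointClouds.

Definition sample_radius2 (R : realType) (X : metricType R) (n : nat)
    (x x' : 'I_n -> X) : R := Num.max (sample_radius x) (sample_radius x').

Lemma sample_radius2l (R : realType) (X : metricType R) (n : nat)
  (x x' : 'I_n -> X) : sample_radius x <= sample_radius2 x x'.
Proof. by rewrite /sample_radius2 le_max lexx. Qed.

Lemma sample_radius2r (R : realType) (X : metricType R) (n : nat)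
  (x x' : 'I_n -> X) : sample_radius x' <= sample_radius2 x x'.
Proof. by rewrite /sample_radius2 le_max lexx orbT. Qed.

(* Main.v *)
Require Import Defs.
From mathcomp Require Import all_boot all_order all_algebra.
From mathcomp Require Import all_classical all_reals all_analysis.
From HB Require Import structures.
From mathcomp Require Import finmap zify lra.
(* Imported last, so that [pmap] denotes the structure maps of a persistence
   module and not the partial map on sequences. *)
Require Import Defs.

Set Implicit Arguments.
Unset Strict Implicit.
Unset Printing Implicit Defensive.
Import Order.TTheory GRing.Theory Num.Theory.
Local Open Scope ring_scope.

(** Put [e := dinfty x x']. A ball of radius [t] around [x i] lies in the ball
of radius [t + e] around [x' i], so the chain groups of [x] at [t] are contained
in those of [x'] at [t + e], inside the same ambient chain spaces and compatibly
with the boundaries and with [psi], which do not depend on the cloud.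

The kernel, image and cokernel of [H_k(psi)] are all of the form [P t / Q t],
where [Q t <= P t] are increasing families of subspaces of one
finite-dimensional space [V] and the structure maps are induced by inclusions
([presents], [presents_ker_psi], [presents_im_psi], [presents_coker_psi]); with
[Z], [B] the cycles and boundaries of the distance complex, and [Z'], [B'] those
of the Cech complex, they are [(Z :&: psi^-1 B') / B], [(psi Z + B') / B'] and
[Z' / (psi Z + B')]. The inclusions above shift these families by [e], in both
directions, so the two modules are [e]-interleaved ([shift_shift]).

Such modules have barcodes: the chains [P] and [Q] have a common adapted basis of
[V] ([adapted_span]), and a basis vector [v] contributes the bar of those [t] with
[v] in [P t] but not in [Q t] ([adapted_is_barcode]). Moreover every barcode of
such a module is finite ([finite_bars]), since the pair of dimensions of [P t] and
[Q t] takes finitely many values and determines the bars alive at [t].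

It remains to match the bars of two [e]-interleaved finite barcodes (algebraic
stability); the argument is Bjerkevik's. In the bases given by the bars the two
shift morphisms are matrices [F] and [G], whose nonzero entries only join bars
with [birth a' <= birth a + e] and [death a' <= death a + e]. Call a bar long if
its length exceeds [2e]. Let [a], [c] be long, and let [c] not precede [a] in the
order by [birth + death], infinite bars last. Then the [(a, c)] entry of [F * G]
is that of the identity, and every [a'] with [F a a' * G a' c != 0] is [e]-close
to [a] or to [c] ([sum_coef_later]). So for a set [A] of long bars with set of
close bars [N], the product of the blocks of [F] and [G] through [N] is
unitriangular, whence [#|A| <= #|N|] ([hall_condition]), and Hall's theorem
([hall]) matches all long bars of one barcode with close bars of the other. Two
such one-sided matchings merge into one covering the long bars on both sides
([merge_matchings]); the bars left over are within [e] of the diagonal. *)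

(** * Matchings in bipartite graphs *)

Section Matchings.
Variables (I J : Type).
Implicit Types m : I -> J -> Prop.

Definition pmatching m :=
  (forall i j j', m i j -> m i j' -> j = j') /\
  (forall i i' j, m i j -> m i' j -> i = i').

(** Follow a vertex on the left along its [m1]-edge and a vertex on the right
along its [m2]-edge: the vertices of [I + J] split into chains and cycles. The
vertices below are those on chains that start on the right. *)
Inductive chain_vertex m1 m2 : I + J -> Prop :=
| ChainStart j : (forall i, ~ m1 i j) -> chain_vertex m1 m2 (inr j)
| ChainBack i j : chain_vertex m1 m2 (inr j) -> m2 i j ->
    chain_vertex m1 m2 (inl i)
| ChainForth i j : chain_vertex m1 m2 (inl i) -> m1 i j ->
    chain_vertex m1 m2 (inr j).

(** As in the proof of the Schroeder-Bernstein theorem: use [m2] on the chains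
that start on the right, and [m1] on all other chains and on the cycles. Every
vertex with an outgoing edge is then covered: either that edge was chosen or
the vertex is the end of a chosen edge. *)
Lemma merge_matchings m1 m2 : pmatching m1 -> pmatching m2 ->
  exists m, [/\ pmatching m, forall i j, m i j -> m1 i j \/ m2 i j,
    forall i j, m1 i j -> exists j', m i j' &
    forall i j, m2 i j -> exists i', m i' j].
Proof.
move=> [f1 g1] [f2 g2]; set W := chain_vertex m1 m2.
have WI i : W (inl i) -> exists2 j, W (inr j) & m2 i j.
  move=> w; inversion w as [|? j wj mij|]; by exists j.
have WJ j : W (inr j) -> (forall i, ~ m1 i j) \/ exists2 i, W (inl i) & m1 i j.
  move=> w; inversion w as [? h| |i ? wi mij]; first by left.
  by right; exists i.
exists (fun i j => (m1 i j /\ ~ W (inl i)) \/ (m2 i j /\ W (inr j))); split.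
- split=> [i j j'|i i' j] [[m wi]|[m wj]] [[m' wi']|[m' wj']].
  + exact: f1 m m'.
  + by case: wi; apply: ChainBack wj' m'.
  + by case: wi'; apply: ChainBack wj m.
  + exact: f2 m m'.
  + exact: g1 m m'.
  + case: (WJ _ wj') => [/(_ _ m)//|[u wu mu]].
    by case: wi; rewrite (g1 _ _ _ m mu).
  + case: (WJ _ wj) => [/(_ _ m')//|[u wu mu]].
    by case: wi'; rewrite (g1 _ _ _ m' mu).
  + exact: g2 m m'.
- by move=> i j [[]|[]]; [left|right].
- move=> i j m; case: (EM (W (inl i))) => wi; last by exists j; left.
  by have [j' wj mij] := WI _ wi; exists j'; right.
- move=> i j m; case: (EM (W (inr j))) => wj; first by exists i; right.
  case: (EM (exists i', m1 i' j)) => [[i' mi]|no].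
    by exists i'; left; split=> // wi; apply: wj; apply: ChainForth wi mi.
  by case: wj; apply: ChainStart => i' mi; apply: no; exists i'.
Qed.

End Matchings.

Definition neighbours (I J : finType) (E : I -> J -> bool) (A : {set I}) : {set J} :=
  [set j | [exists i in A, E i j]]%SET.

(** Hall's marriage theorem, by induction on the set to be covered. If some
nonempty proper subset [A] has no more than [#|A|] neighbours, match [A] and
then its complement with what is left; otherwise every nonempty proper subset
has a spare neighbour, and any edge may be put in the matching. *)
Lemma hall (I J : finType) (E : I -> J -> bool) (L : {set I}) :
  (forall A : {set I}, A \subset L -> (#|A| <= #|neighbours E A|)%N) ->
  exists m : I -> J -> Prop, [/\ pmatching m, forall i j, m i j -> E i j,
    forall i j, m i j -> i \in L & forall i, i \in L -> exists j, m i j].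
Proof.
have [N] := ubnP #|L|; elim: N E L => // N IH E L LN hL.
have [->|[i iL]] := finset.set_0Vmem L.
  by exists (fun _ _ => False); split=> // i; rewrite inE.
case: (EM (exists A : {set I}, [/\ A \proper L, A != finset.set0 &
    (#|neighbours E A| <= #|A|)%N])) => [[A [AL A0 tight]]|loose].
- have AsL := fintype.proper_sub AL.
  have [|B BA|m1 [[f1 g1] e1 d1 c1]] := IH E A.
  + by apply: leq_trans (proper_card AL) _; rewrite -ltnS.
  + by apply: hL; apply: fintype.subset_trans AsL.
  pose E' i j := E i j && (j \notin neighbours E A).
  have [|B BL|m2 [[f2 g2] e2 d2 c2]] := IH E' (L :\: A)%SET.
  + apply: leq_trans (_ : #|L| <= N)%N; last by rewrite -ltnS.
    rewrite -(cardsID A L) (finset.setIidPr AsL) -[X in (X <= _)%N]add1n leq_add2r.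
    by rewrite card_gt0.
  + have BA : [disjoint B & A].
      rewrite disjoint_subset; apply/fintype.subsetP => u /(fintype.subsetP BL).
      by rewrite !inE => /andP[].
    have := hL (A :|: B)%SET.
    rewrite finset.subUset AsL (fintype.subset_trans BL (finset.subsetDl _ _)).
    move=> /(_ isT); rewrite cardsU disjoint_setI0 1?disjoint_sym // cards0 subn0.
    have : neighbours E (A :|: B)%SET \subset (neighbours E A :|: neighbours E' B)%SET.
      apply/fintype.subsetP => j; rewrite !inE => /existsP[u /andP[]].
      rewrite inE => /orP[uA|uB] Euj.
        by apply/orP; left; apply/existsP; exists u; rewrite uA.
      have [//|nj] := boolP [exists i in A, E i j].
      by apply/existsP; exists u; rewrite uB /E' Euj inE nj.
    move=> /subset_leq_card h1 h2.
    have h3 := leq_trans h2 (leq_trans h1 (leq_card_setU _ _).1).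
    by rewrite -(leq_add2l #|A|); apply: leq_trans h3 _; rewrite leq_add2r.
  exists (fun i j => m1 i j \/ m2 i j).
  have dis u j : m1 u j -> m2 u j -> False.
    by move=> /d1 uA /d2; rewrite inE uA.
  have dis1 u j j' : m1 u j -> m2 u j' -> False.
    by move=> /d1 uA /d2; rewrite inE uA.
  have dis2 u u' j : m1 u j -> m2 u' j -> False.
    move=> h1 /e2 /andP[_]; rewrite inE => /existsP[]; exists u.
    by rewrite (d1 _ _ h1) e1.
  split.
  + split=> [u j j'|u u' j] [h|h] [h'|h'].
    * exact: f1 h h'.
    * by case: (dis1 _ _ _ h h').
    * by case: (dis1 _ _ _ h' h).
    * exact: f2 h h'.
    * exact: g1 h h'.
    * by case: (dis2 _ _ _ h h').
    * by case: (dis2 _ _ _ h' h).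
    * exact: g2 h h'.
  + by move=> u j [/e1|/e2/andP[]].
  + by move=> u j [/d1/(fintype.subsetP AsL)//|/d2]; rewrite inE => /andP[].
  + move=> u uL; case uA : (u \in A).
      by have [j ?] := c1 _ uA; exists j; left.
    by have [|j ?] := c2 u; [rewrite inE uA|exists j; right].
- have : (0 < #|neighbours E [set i]|)%N.
    by apply: leq_trans (hL _ _); rewrite ?cards1 // finset.sub1set.
  rewrite card_gt0 => /set0Pn[j]; rewrite inE => /existsP[_ /andP[/set1P -> Eij]].
  pose E' i' j' := E i' j' && (j' != j).
  have [|B BL|m [[f g] e d c]] := IH E' (L :\ i)%SET.
  + by move: LN; rewrite (cardsD1 i L) iL.
  + have [->|B0] := eqVneq B finset.set0; first by rewrite cards0.
    have BpL : B \proper L.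
      by apply: sub_proper_trans BL _; rewrite properD1.
    have : (#|B| < #|neighbours E B|)%N.
      by rewrite ltnNge; apply/negP => h; apply: loose; exists B.
    have : neighbours E B \subset (j |: neighbours E' B)%SET.
      apply/fintype.subsetP => j'; rewrite !inE => /existsP[u /andP[uB Eu]].
      by case: eqVneq => //= jj; apply/existsP; exists u; rewrite uB /E' Eu.
    move=> /subset_leq_card h1 h2; rewrite -ltnS; apply: leq_trans h2 _.
    by apply: leq_trans h1 _; rewrite cardsU1; case: (_ \notin _) => //=; apply: ltnW.
  exists (fun i' j' => (i' = i /\ j' = j) \/ m i' j').
  have di j' : ~ m i j' by move=> /d; rewrite !inE eqxx.
  have dj i' : ~ m i' j by move=> /e /andP[_]; rewrite eqxx.
  split.
  + split=> [u v v' [[-> ->]|h] [[ui ->]|h']|u u' v [[-> ->]|h] [[-> vj]|h']] //.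
    * by case: (di v').
    * by move: h; rewrite ui => /di.
    * exact: f h h'.
    * by case: (dj u').
    * by move: h; rewrite vj => /dj.
    * exact: g h h'.
  + by move=> u v [[-> ->]|/e /andP[]].
  + by move=> u v [[-> _]|/d] //; rewrite !inE => /andP[].
  + move=> u uL; have [->|ui] := eqVneq u i; first by exists j; left.
    by have [|v ?] := c u; [rewrite !inE ui|exists v; right].
Qed.

(** The hypothesis says that [F * G] is unitriangular on [A] for some order,
without naming the order. If [B] had fewer elements than [A], a nonzero row
vector [w'] on [A] would satisfy [w' * F = 0]; apply the hypothesis to the
support [S] of [w'] to get [w' c = 0] for some [c] in [S]. *)
Lemma card_le_of_factorization (K : fieldType) (I J : finType)
    (A : {set I}) (B : {set J}) (F : I -> J -> K) (G : J -> I -> K) :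
  (forall S : {set I}, S \subset A -> S != finset.set0 -> exists2 c, c \in S &
    forall a, a \in S -> \sum_(j in B) F a j * G j c = (a == c)%:R) ->
  (#|A| <= #|B|)%N.
Proof.
move=> h; rewrite leqNgt; apply/negP => BA.
pose M : 'M[K]_(#|A|, #|B|) := \matrix_(i, j) F (enum_val i) (enum_val j).
have : kermx M != 0.
  rewrite -mxrank_eq0 mxrank_ker -lt0n subn_gt0.
  exact: leq_ltn_trans (rank_leq_col M) BA.
move=> /rowV0Pn[v /sub_kermxP vM v0].
pose w' (a : I) : K := \sum_(i < #|A|) (enum_val i == a)%:R * v 0 i.
have wE i : w' (enum_val i) = v 0 i.
  rewrite /w' (bigD1 i) //= eqxx mul1r big1 ?addr0 // => u ui.
  by rewrite (inj_eq enum_val_inj) (negbTE ui) mul0r.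
have wF j : j \in B -> \sum_(a in A) w' a * F a j = 0.
  move=> jB; have := congr1 (fun N : 'rV_ _ => N 0 (enum_rank_in jB j)) vM.
  rewrite !mxE => vMj; rewrite big_enum_val -[RHS]vMj; apply: eq_bigr => i _.
  by rewrite wE !mxE enum_rankK_in.
pose S := [set a in A | w' a != 0]%SET.
have [||c cS hc] := h S.
- by apply/fintype.subsetP => a; rewrite inE => /andP[].
- move: v0; apply: contraNneq => S0; apply/eqP/rowP => i; rewrite mxE.
  have := finset.in_set0 (enum_val i); rewrite -S0 inE enum_valP /= wE.
  by move=> /negbFE/eqP.
have : \sum_(j in B) (\sum_(a in A) w' a * F a j) * G j c = 0.
  by apply: big1 => j jB; rewrite wF // mul0r.
rewrite (eq_bigr (fun j => \sum_(a in A) w' a * (F a j * G j c))); last first.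
  by move=> j _; rewrite mulr_suml; apply: eq_bigr => a _; rewrite mulrA.
rewrite exchange_big /= (bigID (mem S)) /= [X in _ + X]big1 ?addr0; last first.
  move=> a /andP[aA]; rewrite inE aA /= negbK => /eqP ->.
  by rewrite big1 // => j _; rewrite mul0r.
rewrite (bigD1 c) /=; last by rewrite cS; move: cS; rewrite inE => /andP[->].
rewrite -mulr_sumr hc // eqxx mulr1 big1 ?addr0; last first.
  move=> a /andP[/andP[aA aS] ac].
  by rewrite -mulr_sumr hc // (negbTE ac) mulr0.
by move: cS; rewrite inE => /andP[_ /eqP].
Qed.

(** * Bases adapted to two chains of subspaces *)

Lemma exists_argmin (T : Type) (S : T -> Prop) (f : T -> nat) :
  (exists x, S x) -> exists2 x, S x & forall y, S y -> (f x <= f y)%N.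
Proof.
move=> [x Sx]; pose p k := `[< exists2 y, S y & f y = k >].
have p0 : exists k, p k by exists (f x); apply/asboolP; exists x.
case: (ex_minnP p0) => k /asboolP[y Sy <-] h.
by exists y => // z Sz; apply: h; apply/asboolP; exists z.
Qed.

Section AdaptedBasis.
Variables (K : fieldType) (V : vectType K).
Implicit Types (U W H : {vspace V}) (C : {vspace V} -> Prop).

Definition subspace_chain C := forall U U', C U -> C U' -> (U <= U')%VS \/ (U' <= U)%VS.

Lemma hyperplane_over U W : (U <= W)%VS -> U != W ->
  exists H, [/\ (U <= H)%VS, (H <= W)%VS & \dim W = (\dim H).+1].
Proof.
have [N] := ubnP (\dim W - \dim U); elim: N U => // N IH U dN UW nUW.
have UWd : (\dim U < \dim W)%N.
  by move: nUW; rewrite eqEdim UW /= -ltnNge.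
have [w wW wU] : exists2 w, w \in W & w \notin U.
  by apply/subvPn; move: nUW; rewrite eqEsubv UW.
have w0 : w != 0 by apply: contraNneq wU => ->; rewrite mem0v.
have dU : \dim (U + <[w]>)%VS = (\dim U).+1.
  rewrite dimv_disjoint_sum ?dim_vline ?w0 ?addn1 //.
  apply/eqP; rewrite -subv0; apply/subvP => u.
  rewrite memv_cap => /andP[uU /vlineP[k uk]].
  have [k0|k0] := eqVneq k 0; first by rewrite uk k0 scale0r mem0v.
  by case/negP: wU; rewrite -(scalerK k0 w) -uk memvZ.
have [e|ne] := eqVneq (\dim (U + <[w]>)%VS) (\dim W).
  by exists U; split=> //; rewrite -e dU.
have sW : (U + <[w]> <= W)%VS by rewrite subv_add UW -memvE.
have [|||H [h1 h2 h3]] := IH (U + <[w]>)%VS => //.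
- by rewrite dU; move: dN UWd; lia.
- by apply: contraNneq ne => ->.
by exists H; split=> //; apply: subv_trans h1; rewrite addvSl.
Qed.

(** By induction on [W]. Choose a hyperplane [H] of [W] containing every trace
[U :&: W <> W] of the first chain (a finite-dimensional chain has a largest one),
and a vector [v] outside [H] in the smallest trace of the second chain that is
not contained in [H]. Then every trace of either chain contains [v] or lies in
[H], so [v] extends an adapted basis of [H] to one of [W]. *)
Lemma adapted_span C C' W : subspace_chain C -> subspace_chain C' ->
  exists X : seq V, [/\ free X, <<X>>%VS = W &
    forall U, C U \/ C' U -> (U :&: W <= <<[seq x <- X | x \in U]>>)%VS].
Proof.
move=> hC hC'; have [N] := ubnP (\dim W); elim: N W => // N IH W dW.
have [->|W0] := eqVneq W 0%VS.
  exists [::]; split=> [||U _]; rewrite ?nil_free ?span_nil //.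
  by rewrite capv0 sub0v.
(* the hyperplane contains all proper traces of the first chain *)
have [H [HW dH hH]] : exists H, [/\ (H <= W)%VS, \dim W = (\dim H).+1 &
    forall U, C U -> (W <= U)%VS \/ (U :&: W <= H)%VS].
  case: (EM (exists U, C U /\ ~~ (W <= U)%VS)) => [ex|no]; last first.
    have [|H [_ h1 h2]] := @hyperplane_over 0%VS W (sub0v _).
      by rewrite eq_sym W0.
    exists H; split=> // U CU; left; apply/negPn/negP => h; apply: no.
    by exists U.
  have [U [CU WU] maxU] := exists_argmin (fun U => (\dim W - \dim (U :&: W))%N) ex.
  have [|H [h1 h2 h3]] := @hyperplane_over (U :&: W)%VS W (capvSr _ _).
    by apply: contraNneq WU => <-; rewrite capvSl.
  exists H; split=> // U' CU'.
  have [|WU'] := boolP (W <= U')%VS; [by left|right].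
  apply: subv_trans h1.
  case: (hC _ _ CU CU') => UU'; last by rewrite capvS.
  suff /eqP -> : (U :&: W == U' :&: W)%VS by rewrite subvv.
  rewrite eqEdim capvS ?subvv //=.
  have := maxU _ (conj CU' WU'); have := dimvS (capvSr U W).
  have := dimvS (capvSr U' W); lia.
(* the new basis vector lies in every trace of the second chain outside [H] *)
have [v [vW vH hv]] : exists v, [/\ v \in W, v \notin H &
    forall U, C' U -> v \in U \/ (U :&: W <= H)%VS].
  case: (EM (exists U, C' U /\ ~~ (U :&: W <= H)%VS)) => [ex|no]; last first.
    have /subvPn[v vW vH] : ~~ (W <= H)%VS.
      by apply/negP => /dimvS; rewrite dH ltnn.
    exists v; split=> // U CU; right; apply/negPn/negP => h; apply: no.
    by exists U.
  have [U [CU UH] minU] := exists_argmin (fun U => \dim U) ex.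
  have /subvPn[v] := UH; rewrite memv_cap => /andP[vU vW] vH.
  exists v; split=> // U' CU'.
  have [|U'H] := boolP (U' :&: W <= H)%VS; [by right|left].
  have dU := minU _ (conj CU' U'H).
  case: (hC' _ _ CU CU') => [/subvP ->//|UU'].
  by have /eqP -> : U' == U by rewrite eqEdim UU'.
have [|X [fX sX aX]] := IH H; first by rewrite -ltnS -dH.
have WE : W = (<[v]> + H)%VS.
  apply/eqP; rewrite eq_sym eqEdim subv_add -memvE vW HW /= dH.
  rewrite -[X in (X < _)%N]/(\dim H) ltnNge; apply/negP => h.
  have /eqP e : H == (<[v]> + H)%VS by rewrite eqEdim addvSr.
  by move: vH; rewrite e (subvP (addvSl _ _)) // memv_line.
exists (v :: X); split; first by rewrite free_cons sX vH.
  by rewrite span_cons sX -WE.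
move=> U CU /=; apply/subvP => u; rewrite memv_cap => /andP[uU uW].
have stepH : u \in H -> u \in <<[seq x <- X | x \in U]>>%VS.
  by move=> uH; apply: (subvP (aX U CU)); rewrite memv_cap uU.
have [vU|vU] := boolP (v \in U).
  move: uW; rewrite WE => /memv_addP[_ /vlineP[k ->] [h hH' ue]].
  have hU : h \in U by rewrite -(addKr (k *: v) h) -ue rpredD // rpredN memvZ.
  rewrite span_cons ue memv_add ?memvZ ?memv_line //.
  by apply: (subvP (aX U CU)); rewrite memv_cap hU.
apply: stepH; case: CU => CU.
  case: (hH _ CU) => [/subvP/(_ _ vW)|/subvP]; first by rewrite (negbTE vU).
  by apply; rewrite memv_cap uU.
case: (hv _ CU) => [|/subvP]; first by rewrite (negbTE vU).
by apply; rewrite memv_cap uU.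
Qed.

(** In coordinates: a member of one of the chains contains every basis vector
that occurs in one of its elements. *)
Lemma adapted_basis C C' : subspace_chain C -> subspace_chain C' ->
  exists m (X : m.-tuple V), basis_of fullv X /\
    forall U, C U \/ C' U -> forall u i, u \in U -> coord X i u != 0 -> X`_i \in U.
Proof.
move=> hC hC'; have [X [fX sX aX]] := adapted_span fullv hC hC'.
exists (size X), (in_tuple X); split.
  by rewrite basisEfree fX sX subvv /= -sX dim_span.
move=> U CU u i uU; apply: contraNT => XU.
have : u \in <<[seq x <- X | x \in U]>>%VS.
  by apply: (subvP (aX U CU)); rewrite capvf.
move=> /(coord_span (X := in_tuple _)) ->; rewrite linear_sum big1 //= => k _.
have := mem_nth 0 (ltn_ord k); rewrite mem_filter => /andP[xU /(nthP 0)[j jX xj]].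
rewrite linearZ /= -xj.
have := coord_free (Ordinal jX) i (X := in_tuple X) fX; rewrite /= => ->.
case: eqVneq => [ij|]; last by rewrite mulr0.
 by case/negP: XU; rewrite -ij /= xj.
Qed.

End AdaptedBasis.

(** * Persistence modules presented as subquotients *)

Section Presentations.
Variables (K : fieldType) (R : realType) (D : set R).

(** [M t] is the subquotient [P t / Q t] of a fixed space [V], through a map
[q t] of which only the restriction to [P t] matters, and the structure maps of
[M] are induced by the inclusions [P s <= P t]. *)
Record presents (V : vectType K) (P Q : R -> {vspace V}) (M : pmod K D)
    (q : forall t, 'Hom(V, M t)) : Prop := Presents {
  pres_mono : forall s t, D s -> D t -> s <= t -> (P s <= P t)%VS;
  pres_sub : forall t, D t -> (Q t <= P t)%VS;
  pres_onto : forall t w, D t -> exists2 v, v \in P t & q t v = w;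
  pres_ker : forall t v, D t -> v \in P t -> (q t v == 0) = (v \in Q t);
  pres_map : forall s t v, D s -> D t -> s <= t -> v \in P s ->
    pmap M s t (q s v) = q t v }.

Section Basics.
Variables (V : vectType K) (P Q : R -> {vspace V}) (M : pmod K D).
Variable q : forall t, 'Hom(V, M t).
Hypothesis hq : presents P Q q.

Lemma presents_mono_ker s t : D s -> D t -> s <= t -> (Q s <= Q t)%VS.
Proof.
move=> Ds Dt st; apply/subvP => v vQ.
have vP := subvP (pres_sub hq Ds) _ vQ.
rewrite -(pres_ker hq) ?(subvP (pres_mono hq Ds Dt st)) //.
move: vQ; rewrite -(pres_ker hq) // => /eqP qv.
by rewrite -(pres_map hq Ds Dt st vP) qv linear0.
Qed.

Lemma presents_eq (P' Q' : R -> {vspace V}) :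
  (forall t, D t -> P t = P' t) -> (forall t, D t -> Q t = Q' t) ->
  presents P' Q' q.
Proof.
move=> eP eQ; split=> [s t Ds Dt st|t Dt|t w Dt|t v Dt|s t v Ds Dt st];
  rewrite -?eP // -?eQ //.
- exact: pres_mono hq _ _ Ds Dt st.
- exact: pres_sub hq _ Dt.
- exact: pres_onto hq _ _ Dt.
- exact: pres_ker hq _ _ Dt.
- exact: pres_map hq _ _ _ Ds Dt st.
Qed.

(** Submodules and quotients of presented modules are presented by the preimages
in [V]; so kernels, images and cokernels are as well. *)
Lemma presents_psub (Z : forall t, {vspace M t}) (hZ : stable Z) :
  presents (fun t => P t :&: (q t @^-1: Z t))%VS Q
    (M := psub hZ) (fun t => linfun (vsproj (Z t)) \o q t)%VF.
Proof.
have val t v : v \in (P t :&: (q t @^-1: Z t))%VS ->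
    vsval ((linfun (vsproj (Z t)) \o q t)%VF v) = q t v.
  by rewrite memv_cap -memv_preim comp_lfunE lfunE /= => /andP[_ /vsprojK].
have mono s t : D s -> D t -> s <= t ->
    (P s :&: (q s @^-1: Z s) <= P t :&: (q t @^-1: Z t))%VS.
  move=> Ds Dt st; apply/subvP => v; rewrite !memv_cap -!memv_preim.
  move=> /andP[vP vZ]; rewrite (subvP (pres_mono hq Ds Dt st)) //=.
  by rewrite -(pres_map hq Ds Dt st) // (subvP (hZ _ _ Ds Dt st)) // memv_img.
split=> [|t Dt|t w Dt|t v Dt vZ|s t v Ds Dt st vZ].
- exact: mono.
- apply/subvP => v vQ; have vP := subvP (pres_sub hq Dt) _ vQ.
  rewrite memv_cap vP -memv_preim.
  by move: vQ; rewrite -(pres_ker hq) // => /eqP ->; rewrite mem0v.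
- have [v vP vw] := pres_onto hq (vsval w) Dt.
  have vZ : v \in (P t :&: (q t @^-1: Z t))%VS.
    by rewrite memv_cap vP -memv_preim vw subvsP.
  by exists v => //; apply: subvs_inj; rewrite val.
- rewrite -(pres_ker hq Dt); last by move: vZ; rewrite memv_cap => /andP[].
  by rewrite -(inj_eq subvs_inj) val // linear0.
- apply: subvs_inj; rewrite (psub_mapE hZ) // !val //; last first.
    exact: (subvP (mono s t Ds Dt st)).
  by rewrite (pres_map hq) //; move: vZ; rewrite memv_cap => /andP[].
Qed.

Lemma presents_pquot (B : forall t, {vspace M t}) (hB : stable B) :
  presents P (fun t => P t :&: (q t @^-1: B t))%VS
    (M := pquot hB) (fun t => qpi (B t) \o q t)%VF.
Proof.
split=> [|t Dt|t w Dt|t v Dt vP|s t v Ds Dt st vP].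
- exact: pres_mono hq.
- exact: capvSl.
- have [v vP vw] := pres_onto hq (qrep (B t) w) Dt.
  by exists v => //; rewrite comp_lfunE vw qrepK.
- by rewrite comp_lfunE -memv_ker lker_qpi memv_cap vP -memv_preim.
- rewrite [in LHS](comp_lfunE (qpi (B s))) (pquot_mapE hB) //.
  by rewrite [RHS](comp_lfunE (qpi (B t))) (pres_map hq).
Qed.

Lemma presents_iso (N : pmod K D) (f : pmor M N) (g : pmor N M) :
  (forall t, D t -> (g t \o f t)%VF = \1%VF /\ (f t \o g t)%VF = \1%VF) ->
  presents P Q (M := N) (fun t => f t \o q t)%VF.
Proof.
move=> fg; have fK t w : D t -> g t (f t w) = w.
  by move=> /fg[/lfunP/(_ w) + _]; rewrite comp_lfunE id_lfunE.
have gK t w : D t -> f t (g t w) = w.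
  by move=> /fg[_ /lfunP/(_ w)]; rewrite comp_lfunE id_lfunE.
split=> [|t Dt|t w Dt|t v Dt vP|s t v Ds Dt st vP].
- exact: pres_mono hq.
- exact: pres_sub hq _ Dt.
- have [v vP vw] := pres_onto hq (g t w) Dt.
  by exists v => //; rewrite comp_lfunE vw gK.
- rewrite -(pres_ker hq) // comp_lfunE; apply/eqP/eqP => [fq0|->].
    by rewrite -(fK _ (q t v) Dt) fq0 linear0.
  exact: linear0.
- rewrite !comp_lfunE -(comp_lfunE (pmap N s t)) (pfunE f Ds Dt st) comp_lfunE.
  by rewrite (pres_map hq).
Qed.

(** A linear section of [q t] with values in [P t], for [q] as in [presents]. *)
Definition lift t : 'Hom(M t, V) := (projv (P t) \o (q t \o projv (P t))^-1)%VF.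

Lemma lift_mem t w : lift t w \in P t.
Proof. by rewrite comp_lfunE memv_proj. Qed.

Lemma liftK t w : D t -> q t (lift t w) = w.
Proof.
move=> Dt; rewrite comp_lfunE -comp_lfunE limg_lfunVK //.
have [v vP <-] := pres_onto hq w Dt.
by apply/memv_imgP; exists v; rewrite ?memvf // comp_lfunE projv_id.
Qed.

Lemma lift_map t v : D t -> v \in P t -> lift t (q t v) - v \in Q t.
Proof.
move=> Dt vP; rewrite -(pres_ker hq) ?rpredB ?lift_mem //.
by rewrite linearB /= liftK // subrr.
Qed.

End Basics.

Section Morphism.
Variables (V V' : vectType K) (P Q : R -> {vspace V}) (P' Q' : R -> {vspace V'}).
Variables (M N : pmod K D) (q : forall t, 'Hom(V, M t)).
Variables (q' : forall t, 'Hom(V', N t)) (f : pmor M N) (phi : 'Hom(V, V')).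
Hypotheses (hq : presents P Q q) (hq' : presents P' Q' q').
Hypothesis phi_sub : forall t, D t -> (phi @: P t <= P' t)%VS.
Hypothesis phiE : forall t v, D t -> v \in P t -> f t (q t v) = q' t (phi v).

Let phiP t v : D t -> v \in P t -> phi v \in P' t.
Proof. by move=> Dt vP; apply: (subvP (phi_sub Dt)); rewrite memv_img. Qed.

Lemma presents_pker : exists q1,
  presents (fun t => P t :&: (phi @^-1: Q' t))%VS Q (M := pker f) q1.
Proof.
eexists; apply: (presents_eq (presents_psub hq (pker_stable f))) => // t Dt.
apply/vspaceP => v; rewrite !memv_cap -!memv_preim.
case vP : (v \in P t) => //=.
by rewrite memv_ker phiE // (pres_ker hq') // phiP.
Qed.

(** A representative in [P' t] of [f w] differs from [phi u], for a representative
[u] of [w], by an element of [Q' t]. *)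
Let im_eq t : D t ->
  (P' t :&: (q' t @^-1: limg (f t)) = phi @: P t + Q' t)%VS.
Proof.
move=> Dt; apply/vspaceP => v; rewrite !memv_cap -!memv_preim.
apply/andP/memv_addP => [[vP /memv_imgP[w _ vw]]|[_ /memv_imgP[u uP ->] [z zQ ->]]].
  have [u uP uw] := pres_onto hq w Dt.
  exists (phi u); first exact: memv_img.
  exists (v - phi u); last by rewrite addrC subrK.
  rewrite -(pres_ker hq') ?rpredB ?phiP // linearB /= vw -uw phiE //.
  by rewrite subrr.
have zP := subvP (pres_sub hq' Dt) _ zQ.
rewrite rpredD ?phiP //; split=> //; rewrite linearD /= -phiE //.
move: zQ; rewrite -(pres_ker hq') // => /eqP ->.
by rewrite addr0 memv_img // memvf.
Qed.

Lemma presents_pim : exists q1,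
  presents (fun t => phi @: P t + Q' t)%VS Q' (M := pim f) q1.
Proof.
eexists; exact: (presents_eq (presents_psub hq' (pim_stable f)) im_eq
  (fun _ _ => erefl)).
Qed.

Lemma presents_pcoker : exists q1,
  presents P' (fun t => phi @: P t + Q' t)%VS (M := pcoker f) q1.
Proof.
eexists; exact: (presents_eq (presents_pquot hq' (pim_stable f))
  (fun _ _ => erefl) im_eq).
Qed.

End Morphism.

Section Homology.
Variables (C : fcomplex K D) (k : nat).

Definition Zspace (t : R) : {vspace fspace C} := (fch C t k :&: lker (fbd C))%VS.
Definition Bspace (t : R) : {vspace fspace C} := (fbd C @: fch C t k.+1)%VS.

Definition homology_class t : 'Hom(fspace C, homology C k t) :=
  (qpi (boundaries C k t) \o linfun (vsproj (cycles C k t)))%VF.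

Lemma presents_homology : presents Zspace Bspace homology_class.
Proof.
have pc : @presents (fspace C) (fun=> fullv) (fun=> 0%VS) (pconst D (fspace C))
    (fun=> \1%VF).
  split=> [s t _ _ _|t _|t w _|t v _ _|s t v _ _ _ _].
  - exact: subvv.
  - exact: sub0v.
  - by exists w; rewrite ?memvf ?id_lfunE.
  - by rewrite id_lfunE memv0.
  - by rewrite !id_lfunE.
have := presents_pquot (presents_psub pc (@cycles_stable _ _ _ C k))
  (@boundaries_stable _ _ _ C k).
have -> : homology_class = (fun t => qpi (boundaries C k t) \o
    (linfun (vsproj (cycles C k t)) \o \1))%VF.
  by apply: functional_extensionality_dep => t; rewrite comp_lfun1r.
have Zid t : (fullv :&: (\1%VF @^-1: cycles C k t) = Zspace t)%VS.
  by apply/vspaceP => v; rewrite capfv -memv_preim id_lfunE.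
move=> /presents_eq; apply=> t Dt; first exact: Zid.
apply/vspaceP => v; rewrite Zid memv_cap -memv_preim comp_lfun1r.
have [vZ|vZ] /= := boolP (v \in Zspace t).
  by rewrite boundariesP lfunE /= vsprojK.
apply/esym/negbTE; apply: contraNN vZ => /memv_imgP[c cC ->].
rewrite memv_cap (subvP (fbd_sub C k Dt)) ?memv_img //=.
by rewrite memv_ker (fbd2 Dt cC).
Qed.

End Homology.

Section HomologyMap.
Variables (C C' : fcomplex K D) (f : fmap1 C C') (k : nat).

Lemma homology_map_class t v : D t -> v \in Zspace C k t ->
  homology_map f k t (homology_class C k t v) = homology_class C' k.+1 t (f v).
Proof.
move=> Dt vZ; rewrite /homology_class.
rewrite [in LHS](comp_lfunE (qpi (boundaries C k t))).
rewrite [RHS](comp_lfunE (qpi (boundaries C' k.+1 t))) homology_funE //.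
congr (qpi _ _); apply: subvs_inj; rewrite cycles_mapE // !lfunE /=.
rewrite !vsprojK //; move: vZ; rewrite !memv_cap !memv_ker => /andP[vC /eqP v0].
by rewrite (subvP (ffn_sub f k Dt)) ?memv_img //= -(ffn_bd f Dt vC) v0 linear0.
Qed.

Lemma Zspace_map t : D t -> (f @: Zspace C k t <= Zspace C' k.+1 t)%VS.
Proof.
move=> Dt; apply/subvP => _ /memv_imgP[v + ->].
rewrite !memv_cap !memv_ker => /andP[vC /eqP v0].
by rewrite (subvP (ffn_sub f k Dt)) ?memv_img //= -(ffn_bd f Dt vC) v0 linear0.
Qed.

End HomologyMap.

End Presentations.

(** * Barcodes of presented modules *)

Section BarCoordinates.
Variables (K : fieldType) (R : realType) (D : set R) (B : barcode D).
Implicit Types (a : bar_idx B) (t : R).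

(** Coordinates and basis vectors indexed by all bars, so that they can be
compared between parameters; both are zero for bars not alive at [t]. *)
Definition bar_coord a t (c : bars_obj K B t) : K := oapp c 0 (insub a).

Definition bar_vec a t : bars_obj K B t := [ffun b => (val b == a)%:R].

Lemma bar_coord_val t (b : alive B t) (c : bars_obj K B t) :
  bar_coord (val b) c = c b.
Proof. by rewrite /bar_coord valK. Qed.

Lemma bar_coord_dead a t (c : bars_obj K B t) : ~ bar a t -> bar_coord a c = 0.
Proof. by rewrite /bar_coord => na; case: insubP => // b /aliveP. Qed.

Lemma bar_coord_vec a a' t : bar a t ->
  bar_coord a' (bar_vec a t) = (a == a')%:R.
Proof.
move=> at_; rewrite /bar_coord; case: insubP => [b _ ba|] /=.
  by rewrite ffunE ba eq_sym.
by case: eqVneq => // <- /aliveP.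
Qed.

Lemma bar_coord_map a s t (c : bars_obj K B s) : bar a t ->
  bar_coord a (pmap (bars_mod K B) s t c) = bar_coord a c.
Proof.
move=> at_; rewrite /= lfunE /= {1}/bar_coord.
by case: insubP => [b _ ba|/aliveP//] /=; rewrite ffunE ba.
Qed.

Lemma bar_vec_dead a t : ~ bar a t -> bar_vec a t = 0.
Proof.
move=> na; apply/ffunP => b; rewrite !ffunE; case: eqP => // ba.
by case: na; rewrite -ba; apply/aliveP/valP.
Qed.

Lemma bar_vec_map a s t : bar a s ->
  pmap (bars_mod K B) s t (bar_vec a s) = bar_vec a t.
Proof.
move=> as_; apply/ffunP => b; rewrite -[LHS]bar_coord_val.
rewrite bar_coord_map; last by apply/aliveP/valP.
by rewrite bar_coord_vec // ffunE eq_sym.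
Qed.

Lemma bar_coord_linear a t : linear_for *%R (@bar_coord a t).
Proof.
move=> k c d; rewrite /bar_coord; case: insubP => [b _ _|_] /=.
  by rewrite !ffunE.
by rewrite mulr0 addr0.
Qed.

HB.instance Definition _ a t :=
  @GRing.isLinear.Build K (bars_obj K B t) K *%R (@bar_coord a t)
    (@bar_coord_linear a t).

Hypothesis finB : finite_set [set: bar_idx B]%classic.

Definition all_bars : {fset bar_idx B} := fset_set [set: bar_idx B]%classic.

Lemma mem_all_bars a : a \in all_bars.
Proof. by rewrite in_fset_set // in_setE. Qed.

Lemma sum_alive t (W : lmodType K) (F : bar_idx B -> W) (c : bars_obj K B t) :
  \sum_(b : alive B t) c b *: F (val b) =
  \sum_(a <- all_bars) bar_coord a c *: F a.
Proof.
rewrite [RHS](bigID (mem (alive B t))) /= [X in _ + X]big1 ?addr0; last first.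
  by move=> a /aliveP na; rewrite bar_coord_dead // scale0r.
rewrite -[RHS]big_filter.
rewrite [RHS](perm_big (alive B t)) /=; last first.
  apply: uniq_perm => [||a]; rewrite ?filter_uniq ?fset_uniq //.
  by rewrite mem_filter /= mem_all_bars andbT.
rewrite big_seq_fsetE /=; apply: eq_bigr => b _.
by rewrite bar_coord_val.
Qed.

Lemma bar_vec_sum t (c : bars_obj K B t) :
  c = \sum_(a <- all_bars) bar_coord a c *: bar_vec a t.
Proof.
rewrite -sum_alive; apply/ffunP => b; rewrite sum_ffunE (bigD1 b) //= !ffunE.
rewrite eqxx [X in X + _]mulr1 big1 ?addr0 // => b' bb'.
by rewrite !ffunE (inj_eq val_inj) eq_sym (negbTE bb') [LHS]mulr0.
Qed.

End BarCoordinates.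

Section PIso.
Variables (K : fieldType) (R : realType) (D : set R) (M N : pmod K D).

Lemma piso_of_bijective (f : pmor M N) :
  (forall t, D t -> lker (f t) = 0%VS) -> (forall t, D t -> limg (f t) = fullv) ->
  piso N M.
Proof.
move=> inj sur.
have gK t w : D t -> f t ((f t)^-1%VF w) = w.
  by move=> Dt; rewrite limg_lfunVK // sur // memvf.
have fK t v : D t -> (f t)^-1%VF (f t v) = v.
  by move=> Dt; rewrite lker0_lfunK // inj.
have nat s t : D s -> D t -> s <= t ->
    (pmap M s t \o (f s)^-1)%VF = ((f t)^-1 \o pmap N s t)%VF.
  move=> Ds Dt st; apply/lfunP => w; rewrite !comp_lfunE.
  rewrite -[LHS](fK t) //; congr (_ _).
  by rewrite -comp_lfunE -(pfunE f Ds Dt st) comp_lfunE gK.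
pose g : pmor N M := PMor nat.
have fg t : D t -> (g t \o f t)%VF = \1%VF /\ (f t \o g t)%VF = \1%VF.
  by move=> Dt; split; apply/lfunP => w; rewrite comp_lfunE id_lfunE ?fK ?gK.
by exists g, f => t /fg [].
Qed.

End PIso.

Section PresentedBarcodes.
Variables (K : fieldType) (R : realType) (D : set R) (V : vectType K).
Variables (P Q : R -> {vspace V}).

Section Finite.
Variables (B : barcode D) (q : forall t, 'Hom(V, bars_mod K B t)).
Hypothesis hq : presents P Q q.

(** If the dimensions agree then so do the spaces, so the structure map from
[s] to [t] is bijective. *)
Lemma bar_eq_dim a s t : D s -> D t -> s <= t -> \dim (P s) = \dim (P t) ->
  \dim (Q s) = \dim (Q t) -> bar (b := B) a s <-> bar a t.
Proof.
move=> Ds Dt st dP dQ.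
have /eqP eP : P s == P t by rewrite eqEdim (pres_mono hq) //= dP.
have /eqP eQ : Q s == Q t by rewrite eqEdim (presents_mono_ker hq) //= dQ.
split=> [as_|at_].
  have [v vP qv] := pres_onto hq (bar_vec K a s) Ds.
  apply: contrapT => na.
  have := bar_vec_map K t as_; rewrite (bar_vec_dead _ na) -qv (pres_map hq) //.
  move=> /eqP; rewrite (pres_ker hq) -?eP // -eQ -(pres_ker hq) // qv => /eqP.
  move=> /(congr1 (@bar_coord _ _ _ _ a s)); rewrite bar_coord_vec // eqxx.
  by rewrite linear0 => /eqP; rewrite oner_eq0.
have [v vP qv] := pres_onto hq (bar_vec K a t) Dt.
apply: contrapT => na.
have := bar_coord_map (q s v : bars_obj K B s) at_.
rewrite (bar_coord_dead _ na) (pres_map hq) ?eP // qv bar_coord_vec // eqxx.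
by move/eqP; rewrite oner_eq0.
Qed.

(** Every bar meets a parameter [t] realizing one of finitely many pairs of
dimensions; choose one parameter for each pair, and use that only finitely many
bars are alive there. *)
Lemma finite_bars : finite_set [set: bar_idx B]%classic.
Proof.
pose I : finType := ('I_(\dim {:V}).+1 * 'I_(\dim {:V}).+1)%type.
pose rk t : I := (inord (\dim (P t)), inord (\dim (Q t))).
have rkE s t : rk s = rk t -> \dim (P s) = \dim (P t) /\ \dim (Q s) = \dim (Q t).
  move=> [/(congr1 val) + /(congr1 val)]; rewrite /= !inordK //;
  by rewrite ltnS dimvS ?subvf.
pose T (i : I) : set (bar_idx B) :=
  if pselect (exists t, D t /\ rk t = i) is left h
  then [set a | bar a (projT1 (cid h))]%classic else set0.
have : finite_set (\bigcup_(i in [set: I]) T i)%classic.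
  apply: bigcup_finite => // i _; rewrite /T.
  by case: pselect => // h; apply: bar_locally_finite.
apply: sub_finite_set => a _; have [t at_] := bar_nonempty a.
have Dt := bar_sub at_; exists (rk t) => //; rewrite /T.
case: pselect => [h|[]]; last by exists t.
case: (cid h) => s /= [Ds /rkE[dP dQ]].
case: (leP s t) => [st|/ltW ts]; first exact/(bar_eq_dim a Ds Dt st dP dQ).
exact/(bar_eq_dim a Dt Ds ts (esym dP) (esym dQ)).
Qed.

End Finite.

Section Existence.
Variables (M : pmod K D) (q : forall t, 'Hom(V, M t)).
Hypothesis hq : presents P Q q.
Variables (m : nat) (X : m.-tuple V).
Hypothesis hX : basis_of fullv X.
Hypothesis adaptedP : forall t u i, D t -> u \in P t -> coord X i u != 0 ->
  X`_i \in P t.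
Hypothesis adaptedQ : forall t u i, D t -> u \in Q t -> coord X i u != 0 ->
  X`_i \in Q t.

(** The class of [X`_i] in [P t / Q t] is defined and nonzero exactly on this
set, which is convex because [P] and [Q] increase. *)
Definition adapted_bar (i : 'I_m) : set R :=
  [set t | [/\ D t, X`_i \in P t & X`_i \notin Q t]]%classic.

Definition adapted_idx : finType := {i : 'I_m | `[< adapted_bar i !=set0 >]%classic}.

Lemma adapted_convex (a : adapted_idx) s t u : adapted_bar (val a) s ->
  adapted_bar (val a) u -> D t -> s <= t -> t <= u -> adapted_bar (val a) t.
Proof.
move=> [Ds Ps _] [Du _ Qu] Dt st tu; split=> //.
  exact: (subvP (pres_mono hq Ds Dt st)).
by apply: contraNN Qu; exact: (subvP (presents_mono_ker hq Dt Du tu)).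
Qed.

Lemma adapted_sub (a : adapted_idx) : (adapted_bar (val a) `<=` D)%classic.
Proof. by move=> t []. Qed.

Lemma adapted_nonempty (a : adapted_idx) : (adapted_bar (val a) !=set0)%classic.
Proof. exact/asboolP/(valP a). Qed.

Lemma adapted_finite t :
  finite_set [set a : adapted_idx | adapted_bar (val a) t]%classic.
Proof. exact: finite_finset. Qed.

Definition adapted_barcode : barcode D :=
  @Barcode R D adapted_idx _ adapted_sub adapted_nonempty adapted_convex
    adapted_finite.

Let finB : finite_set [set: bar_idx adapted_barcode]%classic.
Proof. exact: (@finite_finset adapted_idx). Qed.

Let aliveE t (b : alive adapted_barcode t) : adapted_bar (val (val b)) t.
Proof. exact: (elimT (aliveP (B := adapted_barcode) t (val b)) (valP b)). Qed.

Let vec (a : adapted_idx) : V := X`_(val a).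

Definition adapted_fun t : 'Hom(bars_mod K adapted_barcode t, M t) :=
  lin_ext (fun b : alive adapted_barcode t => q t (vec (val b))).

Let adapted_funE t (c : bars_obj K adapted_barcode t) : adapted_fun t c =
  \sum_(b : alive adapted_barcode t) c b *: q t (vec (val b)).
Proof. by rewrite lfunE. Qed.

Lemma adapted_natural s t : D s -> D t -> s <= t ->
  (pmap M s t \o adapted_fun s)%VF =
  (adapted_fun t \o pmap (bars_mod K adapted_barcode) s t)%VF.
Proof.
move=> Ds Dt st; apply/lfunP => c; rewrite !comp_lfunE !adapted_funE.
rewrite linear_sum /=.
transitivity (\sum_(b : alive adapted_barcode s) c b *: q t (vec (val b))).
  apply: eq_bigr => b _; rewrite linearZ /= (pres_map hq) //.
  by have [] := aliveE b.
rewrite (sum_alive finB (fun a => q t (vec a))).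
rewrite (sum_alive finB (fun a => q t (vec a)) (pmap (bars_mod K _) s t c)).
apply: eq_bigr => a _; case: (EM (adapted_bar (val a) t)) => at_.
  by rewrite bar_coord_map.
rewrite [in RHS](@bar_coord_dead _ _ _ adapted_barcode) // scale0r.
case: (EM (adapted_bar (val a) s)) => as_; last first.
  by rewrite (@bar_coord_dead _ _ _ adapted_barcode) // scale0r.
have [_ Ps _] := as_; have Pt := subvP (pres_mono hq Ds Dt st) _ Ps.
have : vec a \in Q t by apply: contrapT => /negP Qt; apply: at_.
by rewrite -(pres_ker hq) // => /eqP ->; rewrite scaler0.
Qed.

Lemma adapted_inj t : D t -> lker (adapted_fun t) = 0%VS.
Proof.
move=> Dt; apply/eqP; rewrite -subv0; apply/subvP => c.
rewrite memv_ker memv0 adapted_funE => g0; apply/eqP/ffunP => b; rewrite ffunE.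
pose u := \sum_(b : alive adapted_barcode t) c b *: vec (val b).
have uP : u \in P t.
  by apply: memv_suml => b' _; apply: memvZ; have [] := aliveE b'.
have uQ : u \in Q t.
  rewrite -(pres_ker hq) //; move: g0; congr (_ == _); rewrite linear_sum.
  by apply: eq_bigr => b' _; rewrite linearZ.
have cu : coord X (val (val b)) u = c b.
  rewrite linear_sum (bigD1 b) //= linearZ /= coord_free ?(basis_free hX) //.
  rewrite eqxx mulr1 big1 ?addr0 // => b' bb'.
  rewrite linearZ /= coord_free ?(basis_free hX) //.
  by rewrite (inj_eq val_inj) (inj_eq val_inj) (negbTE bb') mulr0.
apply/eqP; apply: contraT; rewrite -cu => /(adaptedQ Dt uQ).
by have [_ _ /negbTE ->] := aliveE b.
Qed.

(** Expand a lift to [P t] in the basis [X]: the vectors that occur lie in [P t],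
and those in [Q t] vanish in the quotient. *)
Lemma adapted_sur t : D t -> limg (adapted_fun t) = fullv.
Proof.
move=> Dt; apply/vspaceP => w; rewrite memvf.
have [v vP <-] := pres_onto hq w Dt.
pose h (b : alive adapted_barcode t) : 'I_m := val (val b).
have h_inj : injective h by move=> b b' /val_inj/val_inj.
apply/memv_imgP; exists [ffun b => coord X (h b) v]; first exact: memvf.
rewrite adapted_funE [in LHS](coord_basis hX (memvf v)) linear_sum /=.
rewrite (bigID (mem (codom h))) /= [X in _ + X]big1 ?addr0; last first.
  move=> i ih; rewrite linearZ /=.
  have [->|vi] := eqVneq (coord X i v) 0; first by rewrite scale0r.
  have Pi := adaptedP Dt vP vi.
  suff : X`_i \in Q t by rewrite -(pres_ker hq) // => /eqP ->; rewrite scaler0.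
  apply: contraNT ih => Qi; have bi : adapted_bar i t by [].
  have ne : `[< adapted_bar i !=set0 >]%classic by apply/asboolP; exists t.
  have al : (Sub i ne : adapted_idx) \in alive adapted_barcode t by apply/aliveP.
  by apply/codomP; exists [` al]%fset.
rewrite -big_uniq /=; last by rewrite map_inj_uniq // enum_uniq.
rewrite big_map big_enum /=; apply: eq_bigr => b _.
by rewrite linearZ ffunE.
Qed.

Lemma adapted_is_barcode : is_barcode_of M adapted_barcode.
Proof.
apply: (@piso_of_bijective _ _ _ (bars_mod K adapted_barcode) M
  (PMor adapted_natural)).
- exact: adapted_inj.
- exact: adapted_sur.
Qed.

End Existence.

Lemma presented_barcode (M : pmod K D) (q : forall t, 'Hom(V, M t)) :
  presents P Q q -> exists B, is_barcode_of M B.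
Proof.
move=> hq.
have chain (S : R -> {vspace V}) :
    (forall s t, D s -> D t -> s <= t -> (S s <= S t)%VS) ->
    subspace_chain (fun U => exists2 t, D t & U = S t).
  move=> mono _ _ [s Ds ->] [t Dt ->].
  by case: (leP s t) => [st|/ltW ts]; [left|right]; apply: mono.
have [m [X [hX aX]]] := adapted_basis (chain _ (pres_mono hq))
  (chain _ (presents_mono_ker hq)).
exists (adapted_barcode hq X); apply: adapted_is_barcode => // t u i Dt.
  by apply: aX; left; exists t.
by apply: aX; right; exists t.
Qed.

(** The barcode chosen by [Dgm] need not be the one built from an adapted
basis, but its interval module is presented by the same [P] and [Q]. *)
Lemma Dgm_presented (M : pmod K D) (q : forall t, 'Hom(V, M t)) :
  presents P Q q -> exists B : barcode D, Dgm M = diagram_of B /\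
    exists q' : forall t, 'Hom(V, bars_mod K B t),
      presents P Q (D := D) (M := bars_mod K B) q'.
Proof.
move=> hq; rewrite /Dgm; case: pselect => [h|[]]; last exact: presented_barcode hq.
case: (cid h) => B /= [f [g fg]]; exists B; split=> //.
by eexists; apply: (presents_iso hq fg).
Qed.

End PresentedBarcodes.

(** * Endpoints of bars *)

Section Endpoints.
Variables (R : realType) (a0 : R).

Definition birth (B : barcode (above a0)) (a : bar_idx B) : \bar R :=
  ereal_inf (EFin @` bar a)%classic.
Definition death (B : barcode (above a0)) (a : bar_idx B) : \bar R :=
  ereal_sup (EFin @` bar a)%classic.

Variable B : barcode (above a0).

Lemma birth_le (a : bar_idx B) t : bar a t -> (birth a <= t%:E)%E.
Proof. by move=> at_; apply: ereal_inf_lbound; exists t. Qed.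

Lemma le_death (a : bar_idx B) t : bar a t -> (t%:E <= death a)%E.
Proof. by move=> at_; apply: ereal_sup_ubound; exists t. Qed.

Lemma birth_fin (a : bar_idx B) : exists b : R, birth a = b%:E.
Proof.
have [t at_] := bar_nonempty a; have := birth_le at_.
have : (a0%:E <= birth a)%E.
  by apply: le_ereal_inf_tmp => _ [s /bar_sub as_ <-]; rewrite lee_fin ltW.
by case: (birth a) => [b||] //; exists b.
Qed.

Lemma death_gtNy (a : bar_idx B) : death a <> -oo%E.
Proof. by have [t /le_death] := bar_nonempty a; case: (death a). Qed.

Lemma bar_between (a : bar_idx B) t :
  (birth a < t%:E)%E -> (t%:E < death a)%E -> bar a t.
Proof.
move=> /ereal_inf_lt[_ [s as_ <-]] + /ereal_sup_gt[_ [u au <-]].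
rewrite !lte_fin => st tu; apply: (bar_convex as_ au) => //; try exact: ltW.
by apply: lt_trans (bar_sub as_) st.
Qed.

End Endpoints.

Definition close (R : realType) (e : R) (b d b' d' : \bar R) :=
  [&& b <= b' + e%:E, b' <= b + e%:E, d <= d' + e%:E & d' <= d + e%:E]%E.

Lemma real_below (R : realType) (x : R) (d : \bar R) : (x%:E < d)%E ->
  exists2 y : R, x < y & (y%:E <= d)%E.
Proof.
case: d => [d||] //; first by rewrite lte_fin => xd; exists d.
by move=> _; exists (x + 1); rewrite ?ltrDl // leey.
Qed.

(** The bar with endpoints [bc], [dc] does not precede the one with endpoints [b],
[d] in the order by [birth + death], where infinite bars come last and are compared
by their births ([fine] sends the infinite death to 0). *)
Definition later (R : realType) (b d bc dc : \bar R) : Prop :=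
  (d = +oo%E -> dc = +oo%E) /\
  ((d = +oo%E <-> dc = +oo%E) -> (fine b + fine d <= fine bc + fine dc)%R).

(** For finite deaths: if [b'], [d'] were far from both, then one of them would
be more than [e] below the endpoint of the first bar and one of them more than
[e] above that of the second, which makes [bc + dc] smaller than [b + d]. If one
of the deaths is infinite then all are, and only births matter. *)
Lemma close_of_later (R : realType) (e b b' bc : R) (d d' dc : \bar R) :
  d <> -oo%E -> d' <> -oo%E -> dc <> -oo%E ->
  later b%:E d bc%:E dc ->
  (b'%:E <= b%:E + e%:E -> d' <= d + e%:E ->
   bc%:E <= b'%:E + e%:E -> dc <= d' + e%:E ->
   close e b%:E d b'%:E d' \/ close e bc%:E dc b'%:E d')%E.
Proof.
move=> dN d'N dcN [l1 l2]; rewrite !lee_fin => h1 h2 h3 h4.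
case: d dN l1 l2 h2 => [d||] // _ l1 l2 h2; last first.
  rewrite (l1 erefl) /= in l2 h4 *; case: d' h4 {d'N h2} => [d'||] // _.
  left; rewrite /close !lee_fin h1 /= !leey andbT.
  by have := l2 (conj (fun=> erefl) (fun=> erefl)); lra.
case: d' d'N h2 h4 => [d'||] // _ h2 h4; case: dc dcN l1 l2 h4 => [dc||] // _ l1 l2 h4.
have {l2}/= l2 : fine b%:E + fine d%:E <= fine bc%:E + fine dc%:E by apply: l2.
rewrite !lee_fin in h2 h4.
case: (leP b (b' + e)) => hb; last first.
  right; rewrite /close !lee_fin.
  by apply/and4P; split; lra.
case: (leP d (d' + e)) => hd; last first.
  right; rewrite /close !lee_fin.
  by apply/and4P; split; lra.
by left; rewrite /close !lee_fin; apply/and4P; split; lra.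
Qed.

(** Only [b + 2e < dc] needs the order: otherwise [dc <= b + 2e < d] and
[bc < dc - 2e <= b], so the second bar would come before the first. *)
Lemma overlap_of_later (R : realType) (e b bc : R) (d dc : \bar R) :
  dc <> -oo%E -> later b%:E d bc%:E dc ->
  (b%:E + (e + e)%R%:E < d -> bc%:E + (e + e)%R%:E < dc ->
   bc%:E <= b%:E + (e + e)%R%:E -> (0 <= e)%R ->
   exists t, [/\ b%:E < t%:E, t%:E < d, bc%:E < (t + e + e)%R%:E
     & (t + e + e)%R%:E < dc])%E.
Proof.
move=> dcN [l1 l2] la lc; rewrite lee_fin => bb e0.
have [y1 by1 y1d] := real_below la.
have [y2 by2 y2d] : exists2 y : R, b + (e + e) < y & (y%:E <= dc)%E.
  apply: real_below; case: dc dcN l1 l2 lc => [dc||] // _ l1 l2 lc; last exact: ltey.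
  case: d la l1 l2 {y1d} => [d||] //; last by move=> _ /(_ erefl).
  move=> la _ l2.
  have {l2}/= l2 : fine b%:E + fine d%:E <= fine bc%:E + fine dc%:E by apply: l2.
  move: la lc; rewrite !lte_fin; lra.
pose y := Num.min y1 (y2 - (e + e)).
have yb : b < y by rewrite lt_min; apply/andP; split; lra.
have yy1 : y <= y1 by rewrite ge_min lexx.
have yy2 : y <= y2 - (e + e) by rewrite ge_min lexx orbT.
exists ((b + y) / 2); split.
- by rewrite lte_fin; lra.
- by apply: lt_le_trans y1d; rewrite lte_fin; lra.
- by rewrite lte_fin; lra.
- by apply: lt_le_trans y2d; rewrite lte_fin; lra.
Qed.

(** * Matrices of shift morphisms between interval modules *)

Section ShiftMorphisms.
Variables (K : fieldType) (R : realType) (a0 e : R).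
Hypothesis e0 : 0 <= e.
Let D := above a0.

Let Dshift t : D t -> D (t + e).
Proof. by rewrite /D /above /= => Dt; apply: lt_le_trans Dt _; rewrite lerDl. Qed.

Definition shift_natural (M N : pmod K D) (f : forall t, 'Hom(M t, N (t + e))) :=
  forall s t v, D s -> D t -> s <= t ->
    pmap N (s + e) (t + e) (f s v) = f t (pmap M s t v).

Section Coefficients.
Variables (B B' : barcode D).
Variable f : forall t, 'Hom(bars_mod K B t, bars_mod K B' (t + e)).
Hypothesis f_nat : shift_natural f.

Definition coef_at t (a : bar_idx B) (a' : bar_idx B') : K :=
  bar_coord a' (f t (bar_vec K a t)).

Lemma coef_at_supp t a a' : coef_at t a a' != 0 -> bar a t /\ bar a' (t + e).
Proof.
move=> c0; split; apply: contrapT => n; case/negP: c0; apply/eqP.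
  by rewrite /coef_at bar_vec_dead // !linear0.
exact: bar_coord_dead.
Qed.

(** The coefficient does not depend on the parameter as long as both bars are
alive; so it is determined by a single scalar, [coef]. *)
Lemma coef_at_shift s t a a' : s <= t -> bar a s -> D t -> bar a' (t + e) ->
  coef_at s a a' = coef_at t a a'.
Proof.
move=> st as_ Dt a't; rewrite /coef_at -(bar_vec_map K t as_).
rewrite -(f_nat _ (bar_sub as_) Dt st).
by rewrite [RHS]bar_coord_map.
Qed.

(** The image of a dead bar is zero. *)
Lemma coef_at_death t s a a' : coef_at t a a' != 0 -> t <= s ->
  bar a' (s + e) -> D s -> bar a s.
Proof.
move=> c0 ts a's Ds; have [at_ _] := coef_at_supp c0.
by move: c0; rewrite (coef_at_shift ts) // => /coef_at_supp[].
Qed.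

(** The basis vector at [t] comes from [s], and so does its image. *)
Lemma coef_at_birth t s a a' : coef_at t a a' != 0 -> s <= t ->
  bar a s -> bar a' (s + e).
Proof.
move=> c0 st as_; have [at_ a't] := coef_at_supp c0.
have Dt := bar_sub at_.
by move: c0; rewrite -(coef_at_shift st) // => /coef_at_supp[].
Qed.

Definition coef (a : bar_idx B) (a' : bar_idx B') : K :=
  if pselect (exists t, coef_at t a a' != 0) is left h
  then coef_at (projT1 (cid h)) a a' else 0.

Lemma coef_neq0 a a' : coef a a' != 0 -> exists t, coef_at t a a' != 0.
Proof. by rewrite /coef; case: pselect => [//|_]; rewrite eqxx. Qed.

Lemma coefE t a a' : bar a t -> bar a' (t + e) -> coef a a' = coef_at t a a'.
Proof.
move=> at_ a't; rewrite /coef; case: pselect => [h|no]; last first.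
  by apply/eqP; rewrite eq_sym; apply: contrapT => /negP ?; apply: no; exists t.
case: (cid h) => s /= /coef_at_supp[as_ a's].
case: (leP s t) => [st|/ltW ts].
  by apply: coef_at_shift => //; apply: bar_sub at_.
by apply/esym/coef_at_shift => //; apply: bar_sub as_.
Qed.

Lemma coef_birth a a' : coef a a' != 0 -> (birth a' <= birth a + e%:E)%E.
Proof.
move=> /coef_neq0[t c0]; rewrite -leeBlDr //.
apply: le_ereal_inf_tmp => _ [s as_ <-]; rewrite leeBlDr // -EFinD.
case: (leP s t) => [st|/ltW ts]; first exact: birth_le (coef_at_birth c0 st as_).
have [_ /birth_le h] := coef_at_supp c0; apply: le_trans h _.
by rewrite lee_fin lerD2r.
Qed.

Lemma coef_death a a' : coef a a' != 0 -> (death a' <= death a + e%:E)%E.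
Proof.
move=> /coef_neq0[t c0]; apply: ge_ereal_sup => _ [u a'u <-].
rewrite -leeBlDr // -EFinB; have [at_ _] := coef_at_supp c0.
case: (leP t (u - e)) => [tu|/ltW ut].
  apply: le_death; apply: (coef_at_death c0 tu); first by rewrite subrK.
  exact: lt_le_trans (bar_sub at_) tu.
by apply: le_trans (le_death at_); rewrite lee_fin.
Qed.

End Coefficients.

Section OneSided.
Variables (B B' : barcode D).
Hypotheses (finB : finite_set [set: bar_idx B]%classic)
  (finB' : finite_set [set: bar_idx B']%classic).
Variable f : forall t, 'Hom(bars_mod K B t, bars_mod K B' (t + e)).
Variable g : forall t, 'Hom(bars_mod K B' t, bars_mod K B (t + e)).
Hypotheses (f_nat : shift_natural f) (g_nat : shift_natural g).
Hypothesis gf : forall t v, D t ->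
  g (t + e) (f t v) = pmap (bars_mod K B) t (t + e + e) v.

(** The [(a, c)] entry of the composite at [t]. The sum may run over all bars:
if both factors are nonzero then [a'] is alive at [t + e], by the constraints on
births and deaths and by convexity. *)
Lemma sum_coef t (a c : bar_idx B) : bar a t -> bar c (t + e + e) ->
  \sum_(a' <- all_bars B') coef f a a' * coef g a' c = (a == c)%:R.
Proof.
move=> at_ ct; rewrite -(bar_coord_vec K c at_) -(bar_coord_map (t := t + e + e)) //.
have Dt := bar_sub at_.
rewrite -gf // [f t _](bar_vec_sum finB') !linear_sum /=.
apply: eq_bigr => a' _; rewrite !linearZ /=.
case: (EM (bar a' (t + e))) => a't.
  by rewrite (coefE f_nat at_ a't) (coefE g_nat a't ct).
rewrite bar_coord_dead // mul0r; apply/eqP; rewrite mulf_eq0.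
apply: contrapT => /negP; rewrite negb_or => /andP[/coef_neq0[s s0] /coef_neq0[u u0]].
apply: a't; case: (leP t s) => [ts|/ltW st].
  exact: (coef_at_birth f_nat s0 ts at_).
case: (leP u (t + e)) => [ut|/ltW tu].
  by apply: (coef_at_death g_nat u0 ut ct); exact: Dshift.
have [_ a's] := coef_at_supp s0; have [a'u _] := coef_at_supp u0.
by apply: (bar_convex a's a'u) => //; [exact: Dshift|rewrite lerD2r].
Qed.

Definition long (C : barcode D) (a : bar_idx C) : bool :=
  (birth a + (e + e)%R%:E < death a)%E.

Definition bars_close (C C' : barcode D) (a : bar_idx C) (a' : bar_idx C') : bool :=
  close e (birth a) (death a) (birth a') (death a').

(** If [birth c <= birth a + 2e] the bars [a] and [c] overlap after a shift by
[2e] and the composite gives the entry. Otherwise [a <> c] and every product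
vanishes, by the bounds on births. *)
Lemma sum_coef_later (a c : bar_idx B) : long a -> long c ->
  later (birth a) (death a) (birth c) (death c) ->
  \sum_(a' <- all_bars B') coef f a a' * coef g a' c = (a == c)%:R /\
  forall a', coef f a a' * coef g a' c != 0 ->
    bars_close a a' \/ bars_close c a'.
Proof.
rewrite /bars_close /long => la lc lt; split; last first.
  move=> a'; rewrite mulf_eq0 negb_or => /andP[fa ga].
  have := coef_birth f_nat fa; have := coef_death f_nat fa.
  have := coef_birth g_nat ga; have := coef_death g_nat ga.
  have := @death_gtNy _ _ _ a; have := @death_gtNy _ _ _ a'.
  have := @death_gtNy _ _ _ c; move: lt.
  have [b ->] := birth_fin a; have [b' ->] := birth_fin a'.
  have [bc ->] := birth_fin c => *.
  exact: close_of_later.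
case: (EM (birth c <= birth a + (e + e)%R%:E)%E) => [bca|nbca].
  have [t [t1 t2 t3 t4]] : exists t, [/\ birth a < t%:E, t%:E < death a,
      birth c < (t + e + e)%R%:E & (t + e + e)%R%:E < death c]%E.
    have := @death_gtNy _ _ _ c; move: lt la lc bca.
    have [b ->] := birth_fin a; have [bc ->] := birth_fin c => *.
    exact: overlap_of_later.
  by apply: (sum_coef (t := t)); apply: bar_between.
have ac : (a == c) = false.
  apply/negP => /eqP ac; apply: nbca; rewrite ac.
  by have [b ->] := birth_fin c; rewrite -EFinD lee_fin lerDl addr_ge0.
rewrite ac big1 // => a' _; apply/eqP; apply: contrapT => /negP.
rewrite mulf_eq0 negb_or => /andP[/(coef_birth f_nat) fa /(coef_birth g_nat) ga].
apply: nbca; apply: le_trans ga _; rewrite EFinD addeA.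
exact: leeD2r.
Qed.

(** Take an infinite bar with maximal birth if there is an infinite bar, and a
bar with maximal [birth + death] if not. *)
Lemma later_max (S : {set all_bars B}) : S != finset.set0 ->
  exists2 c, c \in S & forall a, a \in S ->
    later (birth (val a)) (death (val a)) (birth (val c)) (death (val c)).
Proof.
move=> /set0Pn[s sS].
pose key (a : all_bars B) := fine (birth (val a)) + fine (death (val a)).
case: (EM (exists2 u, u \in S & death (val u) == +oo%E)) => [[u uS du]|no].
  pose p a := (a \in S) && (death (val a) == +oo%E).
  have pu : p u by rewrite /p uS.
  case: (Order.TotalTheory.arg_maxP (P := p) key pu) => c /andP[cS /eqP dc] maxc.
  exists c => // a aS; split=> [_ //|[_ /(_ dc) da]].
  by apply: maxc; rewrite /p aS da eqxx.
case: (Order.TotalTheory.arg_maxP (P := fun a => a \in S) key sS) => c cS maxc.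
exists c => // a aS; split=> [da|_]; last exact: maxc.
by case: no; exists a; rewrite ?da.
Qed.

Lemma hall_condition (A : {set all_bars B}) :
  (forall a, a \in A -> long (val a)) ->
  (#|A| <= #|neighbours (fun (a : all_bars B) (a' : all_bars B') =>
               bars_close (val a) (val a')) A|)%N.
Proof.
move=> lA; set N := neighbours _ _.
apply: (@card_le_of_factorization K _ _ A N
  (fun a a' => coef f (val a) (val a')) (fun a' c => coef g (val a') (val c))).
move=> S SA /later_max[c cS maxc]; exists c => // a aS.
have aA := fintype.subsetP SA _ aS; have cA := fintype.subsetP SA _ cS.
have [sumE closeE] := sum_coef_later (lA _ aA) (lA _ cA) (maxc _ aS).
rewrite -val_eqE -sumE big_seq_fsetE /= [RHS](bigID (mem N)) /=.
rewrite [X in _ + X]big1 ?addr0 // => a' a'N; apply/eqP; apply: contrapT => /negP.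
move=> /closeE; case=> h; case/negP: a'N; rewrite inE; apply/existsP.
  by exists a; rewrite aA.
by exists c; rewrite cA.
Qed.

Lemma long_bars_matching : exists m : bar_idx B -> bar_idx B' -> Prop,
  [/\ pmatching m, forall a a', m a a' -> bars_close a a' &
    forall a, long a -> exists a', m a a'].
Proof.
pose L := [set a : all_bars B | long (val a)]%SET.
have [|m [[m1 m2] mE _ mL]] := @hall _ _ (fun (a : all_bars B) (a' : all_bars B') =>
               bars_close (val a) (val a')) L.
  move=> A AL; apply: hall_condition => a /(fintype.subsetP AL).
  by rewrite inE.
exists (fun a a' => exists i j, [/\ m i j, val i = a & val j = a']); split.
- split.
    move=> a a' a'' [i [j [mij ia ja]]] [i' [j' [mij' ia' ja']]].
    have ii : i = i' by apply: val_inj; rewrite ia.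
    by rewrite -ja -ja' (m1 _ _ _ mij (_ : m i j')) // ii.
  move=> a a' a'' [i [j [mij ia ja]]] [i' [j' [mij' ia' ja']]].
  have jj : j = j' by apply: val_inj; rewrite ja.
  by rewrite -ia -ia' (m2 _ _ _ mij (_ : m i' j)) // jj.
- by move=> a a' [i [j [/mE + <- <-]]].
- move=> a la; have [|j mj] := mL [` mem_all_bars finB a]%fset; first by rewrite inE.
  by exists (val j), [` mem_all_bars finB a]%fset, j.
Qed.

End OneSided.
End ShiftMorphisms.

(** * The cost of a matching of close bars *)

Section Stability.
Variables (R : realType) (a0 e : R).
Hypothesis e0 : 0 <= e.
Let D := above a0.

Lemma diag_dist_short (B : barcode D) (a : bar_idx B) : ~~ long e a ->
  (diag_dist (diagram_of B a) <= e%:E)%E.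
Proof.
rewrite /diag_dist /= -/(birth a) -/(death a) /long -leNgt.
have := @death_gtNy _ _ _ a; have [b ->] := birth_fin a.
case: (death a) => [d||] // _; rewrite -EFinD lee_fin => h.
by rewrite -EFinB -EFinM lee_fin; lra.
Qed.

Lemma ext_dist_le (x y : \bar R) : (x <= y + e%:E -> y <= x + e%:E ->
  ext_dist x y <= e%:E)%E.
Proof.
rewrite /ext_dist; case: eqP => [_ _ _|]; first by rewrite lee_fin.
case: x => [x||]; case: y => [y||] //= _.
by rewrite !lee_fin ler_norml => ? ?; apply/andP; split; lra.
Qed.

Lemma bottleneck_le_of_matchings (B B' : barcode D)
    (m : bar_idx B -> bar_idx B' -> Prop) : pmatching m ->
  (forall a a', m a a' -> bars_close e a a') ->
  (forall a, long e a -> exists a', m a a') ->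
  (forall a', long e a' -> exists a, m a a') ->
  (bottleneck_dist (diagram_of B) (diagram_of B') <= e%:E)%E.
Proof.
move=> mm mc mL mL'.
apply: (@le_trans _ _ (@matching_cost R (diagram_of B) (diagram_of B') m)).
  by apply: ereal_inf_lbound; exists m.
apply: ge_ereal_sup => c [->|[[a [a' [maa ->]]]|[]]].
- by rewrite lee_fin.
- have /and4P[b1 b2 d1 d2] := mc _ _ maa.
  by rewrite /sup_dist ge_max !ext_dist_le.
- move=> [a [no ->]]; apply: diag_dist_short; apply/negP => /mL[a' /no].
  by [].
- move=> [a [no ->]]; apply: diag_dist_short; apply/negP => /mL'[a' /no].
  by [].
Qed.

End Stability.

(** * Stability for presented modules *)

Section PresentedStability.
Variables (K : fieldType) (R : realType) (a0 e : R).
Hypothesis e0 : 0 <= e.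
Let D := above a0.
Variable V : vectType K.

Let Dshift t : D t -> D (t + e).
Proof. by rewrite /D /above /= => Dt; apply: lt_le_trans Dt _; rewrite lerDl. Qed.

Definition shifted_sub (S S' : R -> {vspace V}) :=
  forall t, D t -> (S t <= S' (t + e)%R)%VS.

Section Shift.
Variables (P Q P' Q' : R -> {vspace V}) (M N : pmod K D).
Variables (q : forall t, 'Hom(V, M t)) (q' : forall t, 'Hom(V, N t)).
Hypotheses (hq : presents P Q q) (hq' : presents P' Q' q').
Hypotheses (PP' : shifted_sub P P') (QQ' : shifted_sub Q Q').

(** Lift to [V], where the inclusions need no map, and project. *)
Definition shift t : 'Hom(M t, N (t + e)) := (q' (t + e) \o lift P q t)%VF.

Lemma shiftE t v : D t -> v \in P t -> shift t (q t v) = q' (t + e) v.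
Proof.
move=> Dt vP; have vPe := subvP (PP' Dt) _ vP.
have lP := subvP (PP' Dt) _ (lift_mem P q (q t v)).
apply/eqP; rewrite comp_lfunE -subr_eq0 -linearB.
rewrite (pres_ker hq' (Dshift Dt)); last exact: memvB.
exact: (subvP (QQ' Dt)) _ (lift_map hq Dt vP).
Qed.

Lemma shift_is_natural : shift_natural shift.
Proof.
move=> s t w Ds Dt st; have [v vP <-] := pres_onto hq w Ds.
rewrite (pres_map hq) // !shiftE //; last exact: (subvP (pres_mono hq Ds Dt st)).
rewrite (pres_map hq') ?lerD2r //; try exact: Dshift.
exact: (subvP (PP' Ds)).
Qed.

End Shift.

Variables (P Q P' Q' : R -> {vspace V}).
Hypotheses (PP' : shifted_sub P P') (QQ' : shifted_sub Q Q').
Hypotheses (PP : shifted_sub P' P) (QQ : shifted_sub Q' Q).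

Lemma shift_shift (M N : pmod K D) (q : forall t, 'Hom(V, M t))
    (q' : forall t, 'Hom(V, N t)) t w :
  presents P Q q -> presents P' Q' q' -> D t ->
  shift P' q' q (t + e) (shift P q q' t w) = pmap M t (t + e + e) w.
Proof.
move=> hq hq' Dt; have [v vP <-] := pres_onto hq w Dt.
rewrite (shiftE hq hq' PP' QQ') // (shiftE hq' hq PP QQ) //.
- rewrite (pres_map hq) //; first by do 2!apply: Dshift.
  by rewrite -addrA lerDl addr_ge0.
- exact: Dshift.
- exact: (subvP (PP' Dt)).
Qed.

End PresentedStability.

Lemma presented_stability (K : fieldType) (R : realType) (a0 e : R)
    (V : vectType K) (P Q P' Q' : R -> {vspace V}) (M N : pmod K (above a0)) :
  0 <= e -> (exists q, presents P Q (M := M) q) ->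
  (exists q', presents P' Q' (M := N) q') ->
  shifted_sub a0 e P P' -> shifted_sub a0 e Q Q' ->
  shifted_sub a0 e P' P -> shifted_sub a0 e Q' Q ->
  (bottleneck_dist (Dgm M) (Dgm N) <= e%:E)%E.
Proof.
move=> e0 [q0 /Dgm_presented[B [-> [q hq]]]] [q0' /Dgm_presented[B' [-> [q' hq']]]].
move=> PP' QQ' PP QQ.
have n := shift_is_natural e0 hq hq' PP' QQ'.
have n' := shift_is_natural e0 hq' hq PP QQ.
have fin := finite_bars hq; have fin' := finite_bars hq'.
have [m1 [mm1 mc1 mL1]] := long_bars_matching e0 fin fin' n n'
  (fun t w => shift_shift e0 PP' QQ' PP QQ w hq hq').
have [m2 [[m2f m2i] mc2 mL2]] := long_bars_matching e0 fin' fin n' n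
  (fun t w => shift_shift e0 PP QQ PP' QQ' w hq' hq).
have [|m [mm msub mL mL']] := merge_matchings mm1 (m2 := fun a a' => m2 a' a).
  split=> [a a' a'' h h'|a a' a'' h h']; [exact: m2i h h'|exact: m2f h h'].
apply: (bottleneck_le_of_matchings e0 mm).
- move=> a a' /msub[/mc1 //|/mc2]; rewrite /bars_close /close.
  by case/and4P=> -> -> -> ->.
- by move=> a /mL1[a' /mL].
- by move=> a' /mL2[a /mL'].
Qed.

(** * The complexes of two nearby point clouds *)

Section CloudComplexes.
Variables (R : realType) (X : metricType R) (n : nat) (K : fieldType).
Variables (a0 e : R).
Let D := above a0.

Section Shift.
Variables (x x' : 'I_n -> X).
Hypothesis near_xx' : forall i, mdist (x i) (x' i) <= e.

Lemma cech_shift t sigma : cech x t sigma -> cech x' (t + e) sigma.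
Proof.
move=> /cechP[s0 [y hy]]; apply/cechP; split=> //; exists y => i /hy.
rewrite !ballEmdist /= => h; rewrite addrC.
apply: le_lt_trans (metric_triangle _ (x i) _) _.
by rewrite metric_sym ler_ltD.
Qed.

Lemma cech_ch_shift k :
  shifted_sub a0 e (cech_ch K x ^~ k) (cech_ch K x' ^~ k).
Proof.
move=> t _; apply: chain_span_sub => sigma /andP[cs sk].
by apply: mem_chain_span; rewrite sk cech_shift.
Qed.

Lemma dc_ch_shift k : shifted_sub a0 e (dc_ch K x ^~ k) (dc_ch K x' ^~ k).
Proof.
move=> t _; apply: chain_span_sub => c /andP[/and3P[cc ij cs] sk].
by apply: mem_chain_span; rewrite sk /dc cc ij cech_shift.
Qed.

Variable k : nat.

Let ZD (y : 'I_n -> X) : R -> {vspace cube_chain n K} :=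
  Zspace (dc_complex K D y) k.
Let BD (y : 'I_n -> X) : R -> {vspace cube_chain n K} :=
  Bspace (dc_complex K D y) k.
Let ZC (y : 'I_n -> X) : R -> {vspace simp_chain K n} :=
  Zspace (cech_complex K D y) k.+1.
Let BC (y : 'I_n -> X) : R -> {vspace simp_chain K n} :=
  Bspace (cech_complex K D y) k.+1.

Lemma cycles_boundaries_shift : [/\ shifted_sub a0 e (ZD x) (ZD x'),
  shifted_sub a0 e (BD x) (BD x'), shifted_sub a0 e (ZC x) (ZC x') &
  shifted_sub a0 e (BC x) (BC x')].
Proof.
split=> t Dt.
- exact: capvS (dc_ch_shift k Dt) (subvv _).
- exact: limgS (dc_ch_shift k.+1 Dt).
- exact: capvS (cech_ch_shift k.+1 Dt) (subvv _).
- exact: limgS (cech_ch_shift k.+2 Dt).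
Qed.

End Shift.

Section PsiPresentation.
Variables (x : 'I_n -> X) (hx : sample_radius x <= a0) (k : nat).

Let C := dc_complex K D x.
Let C' := cech_complex K D x.
Let phi : 'Hom(fspace C, fspace C') := psi n K.

Let hZ := presents_homology C k.
Let hZ' := presents_homology C' k.+1.
Let phi_sub t : D t -> (phi @: Zspace C k t <= Zspace C' k.+1 t)%VS.
Proof. exact: Zspace_map (psi_map K hx) k t. Qed.
Let phiE t v : D t -> v \in Zspace C k t ->
  Hpsi K hx k t (homology_class C k t v) = homology_class C' k.+1 t (phi v).
Proof. exact: homology_map_class. Qed.

Lemma presents_ker_psi : exists q, presents
  (fun t => Zspace C k t :&: (phi @^-1: Bspace C' k.+1 t))%VS (Bspace C k)
  (M := pker (Hpsi K hx k)) q.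
Proof. exact: presents_pker hZ hZ' phi_sub phiE. Qed.

Lemma presents_im_psi : exists q, presents
  (fun t => phi @: Zspace C k t + Bspace C' k.+1 t)%VS (Bspace C' k.+1)
  (M := pim (Hpsi K hx k)) q.
Proof. exact: presents_pim hZ hZ' phi_sub phiE. Qed.

Lemma presents_coker_psi : exists q, presents
  (Zspace C' k.+1) (fun t => phi @: Zspace C k t + Bspace C' k.+1 t)%VS
  (M := pcoker (Hpsi K hx k)) q.
Proof. exact: presents_pcoker hZ hZ' phi_sub phiE. Qed.

End PsiPresentation.

End CloudComplexes.

Section CloudDistance.
Variables (R : realType) (X : metricType R) (n : nat) (x x' : 'I_n -> X).

Lemma mdist_le_dinfty i : mdist (x i) (x' i) <= dinfty x x'.
Proof. by rewrite /dinfty (bigD1 i) //= le_max lexx. Qed.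

Lemma dinfty_ge0 : 0 <= dinfty x x'.
Proof.
rewrite /dinfty; elim/big_ind: _ => // [u v u0 v0|i _]; first by rewrite le_max u0.
exact: mdist_ge0.
Qed.

End CloudDistance.

Local Open Scope ereal_scope.

Theorem mainTheorem5 (R : realType) (X : metricType R) (K : fieldType)
    (n : nat) (hn : (0 < n)%N) (x x' : 'I_n -> X) (k : nat) (F : kic) :
  bottleneck_dist
    (Dgm (pkic F (Hpsi K (sample_radius2l x x') k)))
    (Dgm (pkic F (Hpsi K (sample_radius2r x x') k)))
  <= (dinfty x x')%:E.
Proof.
set hx := sample_radius2l x x'; set hx' := sample_radius2r x x'.
have d i : (mdist (x i) (x' i) <= dinfty x x')%R by exact: mdist_le_dinfty.
have d' i : (mdist (x' i) (x i) <= dinfty x x')%R by rewrite metric_sym mdist_le_dinfty.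
have := cycles_boundaries_shift K (sample_radius2 x x') d k.
have := cycles_boundaries_shift K (sample_radius2 x x') d' k.
move=> [ZD' BD' ZC' BC'] [ZD BD ZC BC].
case: F => /=.
- apply: (presented_stability (dinfty_ge0 x x') (presents_ker_psi K hx k)
    (presents_ker_psi K hx' k)) => // t Dt.
  + by apply: capvS (ZD t Dt) (lpreimS _ (BC t Dt)).
  + by apply: capvS (ZD' t Dt) (lpreimS _ (BC' t Dt)).
- apply: (presented_stability (dinfty_ge0 x x') (presents_im_psi K hx k)
    (presents_im_psi K hx' k)) => // t Dt.
  + by apply: addvS (limgS _ (ZD t Dt)) (BC t Dt).
  + by apply: addvS (limgS _ (ZD' t Dt)) (BC' t Dt).
- apply: (presented_stability (dinfty_ge0 x x') (presents_coker_psi K hx k)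
    (presents_coker_psi K hx' k)) => // t Dt.
  + by apply: addvS (limgS _ (ZD t Dt)) (BC t Dt).
  + by apply: addvS (limgS _ (ZD' t Dt)) (BC' t Dt).
Qed.
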